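(* Let $(M,L)$ be a Berwald--Finsler spacetime, and let $\Gamma^a{}_{bc}$ be the induced affine connection coefficients on $M$. Choose any pseudo-Riemannian metric $g$ on $M$. Then the affine structure of $(M,L)$ is equivalent to the affine structure of the metric-affine geometry $(M,g,\Gamma)$, where the connection defined by the coefficients $\Gamma^a{}_{bc}$ is torsion free, but in general not metric compatible (that is, its non-metricity $Q_{abc}=\nabla_ag_{bc}$ need not vanish). Moreover, $(M,L)$ is metrizable if and only if there exists a pseudo-Riemannian metric $g$ on $M$ such that the non-metricity $Q_{abc}$ vanishes.
   Context: Let $M$ be a smooth $n$-dimensional manifold and $TM$ its tangent bundle with induced local coordinates $(x^a,\dot x^a)$, where $\dot x=\dot x^a\partial_a\in T_xM$. Write $\partial_a=\partial/\partial x^a$ and $\dot\partial_a=\partial/\partial\dot x^a$. Smooth means $C^\infty$. Conic subbundle: a non-empty open submanifold $\mathcal{Q}\subset TM\setminus\{0\}$ such that $\pi(\mathcal{Q})=M$, where $\pi:TM\to M$ is the projection, and such that $(x,\dot x)\in\mathcal{Q}$ implies $(x,\lambda\dot x)\in\mathcal{Q}$ for all $\lambda>0$. Finsler spacetime: a pair $(M,L)$, where $L:\mathcal{A}\to\mathbb{R}$ is a smooth function on a conic subbundle $\mathcal{A}\subset TM$ such that: (i) $L(x,\lambda\dot x)=\lambda^2L(x,\dot x)$ for all $\lambda>0$; (ii) on $\mathcal{A}$ the $L$-metric $g^L_{ab}=\frac12\dot\partial_a\dot\partial_bL$ is nondegenerate; (iii) there is a conic subset $\mathcal{T}\subset\mathcal{A}$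 on which $L>0$ and $g^L$ has Lorentzian signature $(+,-,\dots,-)$, and $L$ can be continuously extended to the boundary $\partial\mathcal{T}$ by $L|_{\partial\mathcal{T}}=0$. (Equivalently, one may use the opposite sign of $L$ and signature $(-,+,\dots,+)$.) Geodesic spray coefficients on $\mathcal{A}$: $G^a=\frac14 (g^L)^{aq}(\dot x^m\partial_m\dot\partial_qL-\partial_qL)$. Berwald--Finsler spacetime: a Finsler spacetime such that $G^a(x,\dot x)=\frac12\Gamma^a{}_{bc}(x)\dot x^b\dot x^c$ with coefficients $\Gamma^a{}_{bc}(x)=\dot\partial_b\dot\partial_cG^a$ depending only on $x$. These are the coefficients of an affine connection $\nabla$ on $M$, the induced affine connection; the affine structure of $(M,L)$ is the one given by this connection. Metrizable: $(M,L)$ is metrizable if there is a pseudo-Riemannian metric on $M$ whose Levi--Civita connection is $\nabla$. Metric-affine geometry: a triple $(M,g,\Gamma)$ of a manifold, a pseudo-Riemannian metric $g$ and an independent affine connection with coefficients $\Gamma^a{}_{bc}$. Given $g$ with Christoffel symbols $\gamma^a{}_{bc}[g]$, write $\Gamma^a{}_{bc}=\gamma^a{}_{bc}[g]+D^a{}_{bc}$ with $D$ a $(1,2)$-tensor field. The non-metricity is $Q_{abc}=\nabla_ag_{bc}=-D^s{}_{ac}g_{sb}-D^s{}_{ab}g_{sc}$. *)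

(* Defs.v *)
From HB Require Import structures.
From mathcomp Require Import all_boot all_order all_algebra.
From mathcomp Require Import all_classical all_reals all_analysis.

Set Implicit Arguments.
Unset Strict Implicit.
Unset Printing Implicit Defensive.

Import Order.TTheory GRing.Theory Num.Theory.
Import numFieldNormedType.Exports.

Local Open Scope classical_set_scope.
Local Open Scope ring_scope.

(* C^infinity on U (meant for open U): every iterated directional derivative,
   of any order and along any directions, is (Fréchet) differentiable on U. *)
Definition smooth_on (R : realType) (V W : normedModType R) (U : set V)
    (f : V -> W) : Prop :=
  forall (s : seq V) (x : V), U x ->
    differentiable (foldr (fun v h => 'D_v h) f s) x.

Definition basis_vec (R : realType) (n : nat) (a : 'I_n) : 'rV[R]_n :=
  delta_mx ord0 a.

(* The entry g_ab of a form is [g a b]; a form in signature (k, n - k) is one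
   that some change of basis brings to diag(1, .., 1, -1, .., -1), k ones. *)
Definition has_signature (R : realType) (n k : nat) (g : 'M[R]_n) : Prop :=
  exists P : 'M[R]_n,
    P \in unitmx /\
    P *m g *m P^T = diag_mx (\row_(i < n) (if (i < k)%N then 1 else -1)).

(* [cmap] and [cinv] are total functions, meaningful only on [cdom] and
   [cimg] respectively. *)
Record chart (R : realType) (n : nat) (M : topologicalType) := Chart {
  cdom : set M;
  cmap : M -> 'rV[R]_n;
  cinv : 'rV[R]_n -> M;
  cdom_open : open cdom;
  cimg_open : open (cmap @` cdom);
  cmapK : forall p, cdom p -> cinv (cmap p) = p;
  cmap_continuous : {within cdom, continuous cmap};
  cinv_continuous : {within cmap @` cdom, continuous cinv}
}.

Definition cimg (R : realType) (n : nat) (M : topologicalType)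
  (c : chart R n M) : set 'rV[R]_n := cmap c @` cdom c.

Definition transition (R : realType) (n : nat) (M : topologicalType)
  (c c' : chart R n M) : 'rV[R]_n -> 'rV[R]_n := cmap c' \o cinv c.

Definition transition_dom (R : realType) (n : nat) (M : topologicalType)
  (c c' : chart R n M) : set 'rV[R]_n :=
  [set x | cimg c x /\ cdom c' (cinv c x)].

(* [chart_at p] is a preferred chart of the atlas around p; it is used only to
   represent tangent vectors at p by their components. *)
Record manifold (R : realType) (n : nat) := Manifold {
  carrier :> topologicalType;
  mfd_hausdorff : hausdorff_space carrier;
  mfd_second_countable : @second_countable carrier;
  atlas : set (chart R n carrier);
  chart_at : carrier -> chart R n carrier;
  chart_at_atlas : forall p, atlas (chart_at p);
  chart_at_dom : forall p, cdom (chart_at p) p;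
  atlas_smooth : forall c c', atlas c -> atlas c' ->
    smooth_on (transition_dom c c') (transition c c')
}.

Section TangentBundle.
Variables (R : realType) (n : nat) (M : manifold R n).

(* (p, v) is the vector of T_pM with components v in the chart [chart_at p].
   The topology and smooth structure of TM are not the product ones: they are
   always read off in the induced coordinates of [tvec]. *)
Definition tangent : Type := (M * 'rV[R]_n)%type.

(* The tangent vector with induced coordinates z = (x, xdot) in the chart c. *)
Definition tvec (c : chart R n M) (z : 'rV[R]_n * 'rV[R]_n) : tangent :=
  let p := cinv c z.1 in
  (p, 'd (transition c (chart_at p)) (z.1) z.2).

Definition tset (c : chart R n M) (W : set tangent) :
  set ('rV[R]_n * 'rV[R]_n) := [set z | cimg c z.1 /\ W (tvec c z)].

Definition conic (W : set tangent) : Prop :=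
  forall p v (l : R), 0 < l -> W (p, v) -> W (p, l *: v).

Definition conic_subbundle (W : set tangent) : Prop :=
  [/\ W !=set0,
      (forall c, atlas c -> open (tset c W)),
      (forall p, ~ W (p, 0)),
      (forall p, exists v, W (p, v))
    & conic W].

(* d/dx^a and d/dxdot^a in induced coordinates (x, xdot) *)
Definition pdx (a : 'I_n) (f : 'rV[R]_n * 'rV[R]_n -> R) :
  'rV[R]_n * 'rV[R]_n -> R := 'D_(basis_vec R a, 0) f.

Definition pdv (a : 'I_n) (f : 'rV[R]_n * 'rV[R]_n -> R) :
  'rV[R]_n * 'rV[R]_n -> R := 'D_(0, basis_vec R a) f.

Definition in_chart (f : tangent -> R) (c : chart R n M) :
  'rV[R]_n * 'rV[R]_n -> R := fun z => f (tvec c z).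

Definition L_metric (L : tangent -> R) (c : chart R n M)
    (z : 'rV[R]_n * 'rV[R]_n) : 'M[R]_n :=
  \matrix_(a, b) (2^-1 * pdv a (pdv b (in_chart L c)) z).

(* [Lbar] is a continuous function on the closure of T, equal to L on T and
   to 0 on the boundary of T in TM. *)
Definition vanishing_extension (T : set tangent) (L Lbar : tangent -> R) :
    Prop :=
  (forall w, T w -> Lbar w = L w) /\
  forall c, atlas c ->
    (forall z, cimg c z.1 -> closure (tset c T) z -> ~ interior (tset c T) z ->
       Lbar (tvec c z) = 0) /\
    {within closure (tset c T) `&` tset c setT, continuous (in_chart Lbar c)}.

End TangentBundle.

(* The values of [fs_L] outside [fs_dom] are irrelevant. *)
Record finsler_spacetime (R : realType) (n : nat) (M : manifold R n) :=
    FinslerSpacetime {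
  fs_dom : set (tangent M);
  fs_L : tangent M -> R;
  fs_dom_conic : conic_subbundle fs_dom;
  fs_smooth : forall c, atlas c ->
    smooth_on (tset c fs_dom) (in_chart fs_L c);
  fs_homogeneous : forall p v (l : R), 0 < l -> fs_dom (p, v) ->
    fs_L (p, l *: v) = l ^+ 2 * fs_L (p, v);
  fs_nondegenerate : forall c z, atlas c -> tset c fs_dom z ->
    L_metric fs_L c z \in unitmx;
  fs_timelike : exists T : set (tangent M),
    [/\ T !=set0, T `<=` fs_dom, conic T,
        (forall w, T w -> 0 < fs_L w) /\
        (forall c z, atlas c -> tset c T z ->
           has_signature 1 (L_metric fs_L c z))
      & exists Lbar, vanishing_extension T fs_L Lbar]
}.

Section Spray.
Variables (R : realType) (n : nat) (M : manifold R n).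
Variable F : finsler_spacetime M.

Definition spray (c : chart R n M) (a : 'I_n) (z : 'rV[R]_n * 'rV[R]_n) : R :=
  4^-1 * \sum_(q < n) invmx (L_metric (fs_L F) c z) a q *
    (\sum_(m < n) z.2 ord0 m * pdx m (pdv q (in_chart (fs_L F) c)) z
     - pdx q (in_chart (fs_L F) c) z).

(* [Gamma c x a b d] stands for the coefficient Gamma^a_{bd}(x) in the chart c. *)
Definition coefficients : Type :=
  chart R n M -> 'rV[R]_n -> 'I_n -> 'I_n -> 'I_n -> R.

Definition spray_coefficient (c : chart R n M) (z : 'rV[R]_n * 'rV[R]_n)
  (a b d : 'I_n) : R := pdv b (pdv d (spray c a)) z.

(* F is a Berwald--Finsler spacetime, with coefficients Gamma. *)
Definition berwald_with (Gamma : coefficients) : Prop :=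
  forall c z, atlas c -> tset c (fs_dom F) z ->
    (forall a, spray c a z =
       2^-1 * \sum_(b < n) \sum_(d < n)
         Gamma c z.1 a b d * z.2 ord0 b * z.2 ord0 d) /\
    (forall a b d, Gamma c z.1 a b d = spray_coefficient c z a b d).

End Spray.

(* Convention: nabla_{d_b} d_d = Gamma^a_{bd} d_a; [conn_law] is the resulting
   transformation law of the coefficients. *)
Record affine_connection (R : realType) (n : nat) (M : manifold R n) :=
    AffineConnection {
  conn_coef : coefficients M;
  conn_smooth : forall c a b d, atlas c ->
    smooth_on (cimg c) (fun x => conn_coef c x a b d);
  conn_law : forall c c' x (a e f : 'I_n), atlas c -> atlas c' ->
    transition_dom c c' x ->
    let phi := transition c c' in
    \sum_(b < n) \sum_(d < n)
      'D_(basis_vec R e) phi x ord0 b * 'D_(basis_vec R f) phi x ord0 d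
        * conn_coef c' (phi x) a b d
    = \sum_(d < n) 'D_(basis_vec R d) phi x ord0 a * conn_coef c x d e f
      - 'D_(basis_vec R e) ('D_(basis_vec R f) phi) x ord0 a
}.

Definition same_connection (R : realType) (n : nat) (M : manifold R n)
    (nabla nabla' : affine_connection M) : Prop :=
  forall c x, atlas c -> cimg c x ->
    forall a b d, conn_coef nabla c x a b d = conn_coef nabla' c x a b d.

Definition torsion_free (R : realType) (n : nat) (M : manifold R n)
    (nabla : affine_connection M) : Prop :=
  forall c x, atlas c -> cimg c x ->
    forall a b d, conn_coef nabla c x a b d = conn_coef nabla c x a d b.

(* A field of bilinear forms is given by its matrix at p in the basis of T_pM
   defined by [chart_at p]; [form_in_chart] is its matrix in the coordinate
   basis of c. *)
Definition form_in_chart (R : realType) (n : nat) (M : manifold R n)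
    (g : M -> 'M[R]_n) (c : chart R n M) (x : 'rV[R]_n) : 'M[R]_n :=
  \matrix_(a, b) ((tvec c (x, basis_vec R a)).2 *m g (cinv c x)
                  *m (tvec c (x, basis_vec R b)).2^T) ord0 ord0.

Record pseudo_riemannian (R : realType) (n : nat) (M : manifold R n) :=
    PseudoRiemannian {
  pr_form : M -> 'M[R]_n;
  pr_sym : forall p, (pr_form p)^T = pr_form p;
  pr_nondegenerate : forall p, pr_form p \in unitmx;
  pr_signature : exists k, forall p, has_signature k (pr_form p);
  pr_smooth : forall c a b, atlas c ->
    smooth_on (cimg c) (fun x => form_in_chart pr_form c x a b)
}.

Section Metric.
Variables (R : realType) (n : nat) (M : manifold R n).

Definition metric_comp (g : pseudo_riemannian M) (c : chart R n M)
  (a b : 'I_n) (x : 'rV[R]_n) : R := form_in_chart (pr_form g) c x a b.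

Definition partial (a : 'I_n) (f : 'rV[R]_n -> R) : 'rV[R]_n -> R :=
  'D_(basis_vec R a) f.

Definition christoffel (g : pseudo_riemannian M) : coefficients M :=
  fun c x a b d =>
    2^-1 * \sum_(s < n) invmx (form_in_chart (pr_form g) c x) a s *
      (partial b (metric_comp g c s d) x + partial d (metric_comp g c s b) x
       - partial s (metric_comp g c b d) x).

Definition is_levi_civita (g : pseudo_riemannian M)
    (nabla : affine_connection M) : Prop :=
  forall c x, atlas c -> cimg c x ->
    forall a b d, conn_coef nabla c x a b d = christoffel g c x a b d.

Record metric_affine := MetricAffine {
  ma_metric : pseudo_riemannian M;
  ma_connection : affine_connection M
}.

(* Q_abd = nabla_a g_bd *)
Definition nonmetricity (A : metric_affine) (c : chart R n M) (x : 'rV[R]_n)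
    (a b d : 'I_n) : R :=
  let g := metric_comp (ma_metric A) c in
  let Gamma := conn_coef (ma_connection A) c x in
  partial a (g b d) x - \sum_(s < n) Gamma s a b * g s d x
  - \sum_(s < n) Gamma s a d * g b s x.

Definition metric_compatible (A : metric_affine) : Prop :=
  forall c x, atlas c -> cimg c x -> forall a b d, nonmetricity A c x a b d = 0.

Variable F : finsler_spacetime M.

Definition induced_connection (nabla : affine_connection M) : Prop :=
  berwald_with F (conn_coef nabla).

(* The affine structure of (M, L) is its induced affine connection; that of a
   metric-affine geometry is its connection. *)
Definition same_affine_structure (A : metric_affine) : Prop :=
  exists2 nabla, induced_connection nabla
               & same_connection nabla (ma_connection A).

Definition metrizable : Prop :=
  exists g : pseudo_riemannian M,
    exists2 nabla, induced_connection nabla & is_levi_civita g nabla.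

End Metric.

(* Main.v *)
(* The Euler-Lagrange expression of L picks up, under a change of chart phi, only
   a term quadratic in the velocities with coefficients the second derivatives
   of phi; hence the spray coefficients obey
     dphi(G) = G' + (1/2) d^2phi(xdot, xdot).
   For a Berwald spray both sides are quadratic forms in xdot that agree on a
   non-empty open set, so polarization gives the transformation law of
   connection coefficients.  As Gamma is a second velocity derivative of G it
   is symmetric, and Gamma(x) = (pdv pdv G)(x, v) with v frozen shows that it is
   smooth.  A torsion-free connection is the Levi-Civita connection of g exactly
   when nabla g = 0, whence the characterization of metrizability.  For the last
   claim, Minkowski space has Gamma = 0, and a conformal rescaling of the
   Euclidean metric is not parallel. *)

From HB Require Import structures.
Require Import Defs.
From mathcomp Require Import all_boot all_order all_algebra.
From mathcomp Require Import all_classical all_reals all_analysis.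
From mathcomp Require Import ring lra.

Set Implicit Arguments.
Unset Strict Implicit.
Unset Printing Implicit Defensive.

Import Order.TTheory GRing.Theory Num.Theory.
Import numFieldNormedType.Exports.

Local Open Scope classical_set_scope.
Local Open Scope ring_scope.

(** * Differential calculus *)

(** Symmetry of second derivatives is not built into [smooth_on], which only asks each iterated
    directional derivative to be differentiable. It is proved as [derive_swap] and enters as
    symmetry of the Hessian of phi, which cancels the terms in [dL/dxdot] when the Euler-Lagrange
    expression changes charts, and as symmetry of the L-metric. Polarization sees only the symmetric
    part of a coefficient array. The defect of the connection law is symmetric because [Gamma] is so
    in both charts; hence the symmetry of [Gamma] has to precede the law. Everything known about F
    lives over [fs_dom]. Its openness provides room to differentiate inside a fibre, and its meeting
    every fibre carries the conclusions to all points of M. Evaluation at one admissible vector also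
    makes the induced connection unique, which matters because [metrizable] speaks of some induced
    connection. *)

Section Derivatives.
Variable R : realType.
Implicit Types V W : normedModType R.

Lemma derive_comp V W (X : normedModType R) (f : V -> W) (g : W -> X) x v :
  differentiable f x -> differentiable g (f x) ->
  'D_v (g \o f) x = 'D_('D_v f x) g (f x).
Proof.
move=> df dg; rewrite !deriveE//; last exact: differentiable_comp.
by rewrite diff_comp.
Qed.

Lemma near_eq_differentiable V W (f g : V -> W) x :
  (\near x, f x = g x) -> differentiable f x -> differentiable g x.
Proof.
move=> fg df.
have [cd fE] : continuous ('d f x) /\ g \o shift x = cst (g x) + 'd f x +o_ 0 id.
  split; first exact: diff_continuous.
  have /eqaddoP fo := diff_locally df.
  apply/eqaddoP => e /fo; apply: filterS2 ((nbhs0P _ _).1 fg) => h /= fgh.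
  by rewrite !fctE/= -(nbhs_singleton fg) (addrC h) fgh.
(* ['d g x] is a chosen differential of [g]; uniqueness identifies it with ['d f x], which satisfies
   the same expansion. *)
by apply/diff_locallyP; rewrite (diff_unique cd fE).
Qed.

Lemma differentiable_bound V W (f : V -> W) x e :
  differentiable f x -> 0 < e -> exists2 d, 0 < d &
    forall h, `|h| < d -> `|f (h + x) - f x - 'D_h f x| <= e * `|h|.
Proof.
move=> df e0; have /eqaddoP/(_ e e0) := diff_locally df.
move=> /nbhs_norm0P[d /= d0 dP]; exists d => // h /dP /=.
by rewrite !fctE /= deriveE// opprD addrA.
Qed.

Lemma is_derive_line V W (f : V -> W) x v (s : R) :
  differentiable f (s *: v + x) ->
  is_derive s 1 (fun s => f (s *: v + x)) ('D_v f (s *: v + x)).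
Proof.
move=> df.
have E : (fun h : R => h^-1 *: (((fun s => f (s *: v + x)) \o shift s) (h *: 1) - f (s *: v + x)))
   = (fun h : R => h^-1 *: ((f \o shift (s *: v + x)) (h *: v) - f (s *: v + x))).
  apply/funext => h /=; congr (_ *: (f _ - _)).
  by rewrite scalerDl addrA /GRing.scale/= mulr1.
have dv : derivable f (s *: v + x) v by exact: diff_derivable.
by apply: DeriveDef; [rewrite /derivable E | rewrite /derive E].
Qed.

(* Mean value theorem for s |-> f (s u + t w + x) - f (s u + x) on [0, t]. *)
Let second_difference V (f : V -> R) x u w e :
  (\near x, differentiable f x) -> differentiable ('D_u f) x -> 0 < e ->
  exists2 d, 0 < d & forall t, 0 < t < d ->
    `|f (t *: u + (t *: w + x)) - f (t *: u + x) - f (t *: w + x) + f x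
      - t ^+ 2 * 'D_w ('D_u f) x| <= e * t ^+ 2 * (`|u| *+ 2 + `|w|).
Proof.
move=> /nbhs0P/nbhs_norm0P[d1 /= d10 d1P] dDu e0.
have [d2 d20 d2P] := differentiable_bound dDu e0.
(* [t * N] bounds every displacement [s u] and [s u + t w] with [0 <= s <= t]; the summand 1 keeps
   [N] positive when [u = w = 0]. *)
pose N := `|u| + `|w| + 1.
have N0 : 0 < N by rewrite /N ltr_wpDl// addr_ge0.
pose d := Num.min d1 d2 / N.
have d0 : 0 < d by rewrite divr_gt0// lt_min d10.
exists d => // t /andP[t0 td].
have small s : 0 <= s <= t -> forall y, y = t *: w \/ y = 0 ->
    `|s *: u + y| < d1 /\ `|s *: u + y| < d2.
  move=> /andP[s0 st] y hy; apply/andP; rewrite -lt_min.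
  apply: (@le_lt_trans _ _ (t * N)); last by rewrite -ltr_pdivlMr.
  apply: le_trans (ler_normD _ _) _.
  rewrite normrZ ger0_norm// /N !mulrDr -addrA lerD// ?ler_wpM2r//.
  rewrite mulr1; case: hy => ->; last by rewrite normr0 addr_ge0// ?mulr_ge0// ltW.
  by rewrite normrZ gtr0_norm// lerDl ltW.
pose g s := f (s *: u + (t *: w + x)) - f (s *: u + x).
pose dg s := 'D_u f (s *: u + (t *: w + x)) - 'D_u f (s *: u + x).
have gE s : 0 <= s <= t -> is_derive s 1 g (dg s).
  move=> st; apply: is_deriveB; apply: is_derive_line.
    have [/d1P ? _] := small s st _ (or_introl erefl).
    by rewrite addrA addrC.
  have [/d1P ? _] := small s st _ (or_intror erefl).
  by rewrite addrC -[s *: u]addr0.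
have [| |c /itvP ct] := @MVT R g dg 0 t t0.
- by move=> s /itvP st; apply: gE; rewrite !st.
- apply: continuous_in_subspaceT => s /set_mem/= /itvP st.
  apply: differentiable_continuous; apply/derivable1_diffP.
  by have [] := gE s ltac:(by rewrite !st).
rewrite /g !scale0r !add0r subr0 => gt.
pose A := 'd ('D_u f) x.
have cst' : 0 <= c <= t by rewrite !ct.
have [_ /d2P h1] := small c cst' _ (or_introl erefl).
have [_ /d2P h2] := small c cst' _ (or_intror erefl).
rewrite addr0 in h2.
have AE v : 'D_v ('D_u f) x = A v by exact: deriveE.
rewrite !AE in h1 h2 *.
have -> : f (t *: u + (t *: w + x)) - f (t *: u + x) - f (t *: w + x) + f x
  = t * dg c by rewrite mulrC -gt; lra.
(* Both values of ['D_u f] are expanded at [x]. By linearity of [A] the unknown [c] drops out of the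
   main term, leaving [A (t w)] and two small remainders. *)
have -> : t * dg c - t ^+ 2 * A w = t *
  (('D_u f (c *: u + t *: w + x) - 'D_u f x - A (c *: u + t *: w))
   - ('D_u f (c *: u + x) - 'D_u f x - A (c *: u))).
  have AZ : A (t *: w) = t * A w by exact: linearZ.
  rewrite [A (c *: u + _)]linearD AZ /dg [c *: u + (_ + x)]addrA.
  by ring.
rewrite normrM gtr0_norm//.
set N' := _ + `|w|; have -> : e * t ^+ 2 * N' = t * (e * (t * N')) by ring.
rewrite ler_pM2l//.
apply: le_trans (ler_normB _ _) _.
apply: le_trans (lerD h1 h2) _.
rewrite -mulrDr ler_pM2l// /N'.
have : `|c *: u| <= t * `|u| by rewrite normrZ ger0_norm ?ct// ler_wpM2r// ct.
have := ler_normD (c *: u) (t *: w).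
rewrite [`|t *: w|]normrZ (gtr0_norm t0) mulrDr mulr2n mulrDr; lra.
Qed.

(** Young's form of the Schwarz theorem: the second difference of [f] along [t u] and [t w] is
    symmetric in [u] and [w], and up to o(t^2) it equals [t^2] times either mixed derivative. *)
Lemma derive_swap V (f : V -> R) x u w :
  (\near x, differentiable f x) ->
  differentiable ('D_u f) x -> differentiable ('D_w f) x ->
  'D_w ('D_u f) x = 'D_u ('D_w f) x.
Proof.
move=> df du dw; apply/eqP; rewrite -subr_eq0 -normr_le0.
pose N := (`|u| *+ 2 + `|w|) + (`|w| *+ 2 + `|u|) + 1.
have N0 : 0 < N by rewrite /N ltr_wpDl// !addr_ge0// mulrn_wge0.
apply/ler_addgt0Pr => e e0; rewrite add0r.
have e'0 : 0 < e / N by rewrite divr_gt0.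
have [d1 d10 h1] := second_difference w df du e'0.
have [d2 d20 h2] := second_difference u df dw e'0.
pose t := Num.min d1 d2 / 2.
have t0 : 0 < t by rewrite divr_gt0// lt_min d10.
have : t < Num.min d1 d2 by rewrite ltr_pdivrMr// ltr_pMr ?ltr1n// lt_min d10.
rewrite lt_min => /andP[td1 td2].
have := h1 t; rewrite t0 td1 => /(_ isT) {}h1.
have := h2 t; rewrite t0 td2 => /(_ isT) {}h2.
rewrite (addrCA (t *: w)) in h2.
have T0 : 0 < t ^+ 2 by rewrite exprn_gt0.
rewrite -(ler_pM2l T0) -{1}(gtr0_norm T0) -normrM mulrBr.
move: h1 h2; move: ('D_w ('D_u f) x) ('D_u ('D_w f) x) => a b h1 h2.
have -> : t ^+ 2 * e = e / N * t ^+ 2 * N by field; rewrite gt_eqF.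
have -> : t ^+ 2 * a - t ^+ 2 * b = (f (t *: u + (t *: w + x)) - f (t *: w + x) - f (t *: u + x) + f x - t ^+ 2 * b)
  - (f (t *: u + (t *: w + x)) - f (t *: u + x) - f (t *: w + x) + f x - t ^+ 2 * a) by ring.
apply: le_trans (ler_normB _ _) _; apply: le_trans (lerD h2 h1) _.
rewrite -mulrDr ler_pM2l; last by rewrite mulr_gt0.
by rewrite /N; move: (`|u|) (`|w|) => a' b'; lra.
Qed.

End Derivatives.

(** * Closure properties of smooth maps *)

Section Smooth.
Variables (R : realType) (V : normedModType R).
Implicit Types (W : normedModType R) (U : set V).

(** Slicing [smooth_on] by order permits induction on [k] in the product and inverse rules, where a
    derivative again contains the undifferentiated functions. Level 0 already demands
    differentiability. *)
Fixpoint Ck (k : nat) W U (f : V -> W) : Prop :=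
  (forall x, U x -> differentiable f x) /\
  if k is k'.+1 then forall v, Ck k' U ('D_v f) else True.

Lemma smooth_onP W U (f : V -> W) : smooth_on U f <-> forall k, Ck k U f.
Proof.
split=> [+ k|].
  elim: k f => [|k IH] f sf /=; (split=> [x Ux|//]; first exact: (sf [::])).
  (* In [foldr] the last direction is differentiated first, so lists of directions grow on the
     right. *)
  move=> v; apply: IH => s x Ux.
  by have := sf (rcons s v) x Ux; rewrite foldr_rcons.
move=> + s; elim/last_ind: s f => [|s v IH] f cf x Ux; first exact: (cf 0).1.
by rewrite foldr_rcons; apply: IH => // k; exact: (cf k.+1).2.
Qed.

Lemma smooth_differentiable W U (f : V -> W) x :
  smooth_on U f -> U x -> differentiable f x.
Proof. by move=> sf; exact: (sf [::]). Qed.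

Lemma smooth_derive W U (f : V -> W) v : smooth_on U f -> smooth_on U ('D_v f).
Proof. by move=> sf s x; have := sf (rcons s v) x; rewrite foldr_rcons. Qed.

Lemma smooth_union W (I : Type) (D : I -> set V) U (f : V -> W) :
  (forall x, U x -> exists2 i, D i x & smooth_on (D i) f) -> smooth_on U f.
Proof. by move=> UD s x /UD[i Dx sf]; exact: sf. Qed.

Lemma open_eq_near W U (f g : V -> W) x : open U -> (forall y, U y -> f y = g y) ->
  U x -> \near x, f x = g x.
Proof.
by move=> oU fg Ux; apply: filterS (open_nbhs_nbhs (conj oU Ux)) => y /fg.
Qed.

Lemma eq_Ck k W U (f g : V -> W) : open U -> (forall x, U x -> f x = g x) ->
  Ck k U f -> Ck k U g.
Proof.
move=> oU; elim: k f g => [|k IH] f g fg [df Df]; (split; last move=> //).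
- by move=> x Ux; exact: near_eq_differentiable (open_eq_near oU fg Ux) (df x Ux).
- by move=> x Ux; exact: near_eq_differentiable (open_eq_near oU fg Ux) (df x Ux).
- move=> v; apply: IH (Df v) => x Ux; apply: near_eq_derive; exact: open_eq_near fg Ux.
Qed.

Lemma eq_smooth W U (f g : V -> W) : open U -> (forall x, U x -> f x = g x) ->
  smooth_on U f -> smooth_on U g.
Proof. by move=> oU fg /smooth_onP sf; apply/smooth_onP => k; exact: eq_Ck (sf k). Qed.

Lemma CkS k W U (f : V -> W) : Ck k.+1 U f -> Ck k U f.
Proof. by elim: k f => [|k IH] f [df Df]; split=> // v; exact: IH. Qed.

Lemma Ck_cst k W U (a : W) : Ck k U (cst a).
Proof.
elim: k a => [|k IH] a; (split=> [x _|//]; first exact: differentiable_cst) => v.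
rewrite (_ : 'D_v _ = cst 0) //; apply/funext => x; exact: derive_cst.
Qed.

Lemma CkD k W U (f g : V -> W) : open U -> Ck k U f -> Ck k U g -> Ck k U (f \+ g).
Proof.
move=> oU; elim: k f g => [|k IH] f g [df Df] [dg Dg];
  (split=> [x Ux|//]; first exact: differentiableD (df x Ux) (dg x Ux)) => v.
apply: eq_Ck (IH _ _ (Df v) (Dg v)) => // x Ux.
by rewrite [RHS]deriveD//; apply: diff_derivable; [exact: df|exact: dg].
Qed.

Lemma CkM k U (f g : V -> R) : open U -> Ck k U f -> Ck k U g -> Ck k U (f \* g).
Proof.
move=> oU; elim: k f g => [|k IH] f g cf cg; have [df Df] := cf; have [dg Dg] := cg;
  (split=> [x Ux|//]; first exact: differentiableM (df x Ux) (dg x Ux)) => v.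
apply: eq_Ck (CkD oU (IH _ _ (CkS cf) (Dg v)) (IH _ _ (CkS cg) (Df v))) => // x Ux.
by rewrite [RHS]deriveM//; apply: diff_derivable; [exact: df|exact: dg].
Qed.

Lemma smoothD W U (f g : V -> W) : open U ->
  smooth_on U f -> smooth_on U g -> smooth_on U (fun x => f x + g x).
Proof.
move=> oU /smooth_onP sf /smooth_onP sg; apply/smooth_onP => k.
exact: CkD (sf k) (sg k).
Qed.

Lemma smoothM U (f g : V -> R) : open U ->
  smooth_on U f -> smooth_on U g -> smooth_on U (fun x => f x * g x).
Proof.
move=> oU /smooth_onP sf /smooth_onP sg; apply/smooth_onP => k.
exact: CkM (sf k) (sg k).
Qed.

Lemma smooth_cst W U (a : W) : smooth_on U (fun=> a).
Proof. by apply/smooth_onP => k; exact: Ck_cst. Qed.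

Lemma smoothN U (f : V -> R) : open U ->
  smooth_on U f -> smooth_on U (fun x => - f x).
Proof.
move=> oU sf; apply: (eq_smooth oU _ (smoothM oU (@smooth_cst R U (-1)) sf)) => x _.
by rewrite mulN1r.
Qed.

Lemma smoothB U (f g : V -> R) : open U ->
  smooth_on U f -> smooth_on U g -> smooth_on U (fun x => f x - g x).
Proof. by move=> oU sf sg; apply: smoothD => //; exact: smoothN. Qed.

Lemma smooth_sum W U (I : Type) (r : seq I) (P : pred I) (F : I -> V -> W) :
  open U -> (forall i, P i -> smooth_on U (F i)) ->
  smooth_on U (fun x => \sum_(i <- r | P i) F i x).
Proof.
move=> oU sF; elim: r => [|i r IH].
  by rewrite (_ : (fun=> _) = fun=> 0); [exact: smooth_cst | apply/funext => x; rewrite big_nil].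
rewrite (_ : (fun=> _) = fun x => (if P i then F i x else 0) + \sum_(i <- r | P i) F i x).
  by apply: smoothD => //; case: (boolP (P i)) => [/sF|_] //; exact: smooth_cst.
by apply/funext => x; rewrite big_cons; case: ifP => //; rewrite add0r.
Qed.

Lemma smooth_prod U (I : Type) (r : seq I) (P : pred I) (F : I -> V -> R) :
  open U -> (forall i, P i -> smooth_on U (F i)) ->
  smooth_on U (fun x => \prod_(i <- r | P i) F i x).
Proof.
move=> oU sF; elim: r => [|i r IH].
  by rewrite (_ : (fun=> _) = fun=> 1); [exact: smooth_cst | apply/funext => x; rewrite big_nil].
rewrite (_ : (fun=> _) = fun x => (if P i then F i x else 1) * \prod_(i <- r | P i) F i x).
  by apply: smoothM => //; case: (boolP (P i)) => [/sF|_] //; exact: smooth_cst.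
by apply/funext => x; rewrite big_cons; case: ifP => //; rewrite mul1r.
Qed.

(** The derivative [- (1/f)^2 f'] is a product of functions of the lower level, so the induction
    closes through [CkM]. *)
Lemma CkV k U (f : V -> R) : open U -> (forall x, U x -> f x != 0) ->
  Ck k U f -> Ck k U (fun x => (f x)^-1).
Proof.
move=> oU f0; elim: k f f0 => [|k IH] f f0 cf; have [df Df] := cf;
  (split=> [x Ux|//]; first exact: differentiableV (df x Ux) (f0 x Ux)) => v.
have sV := IH f f0 (CkS cf).
apply: (eq_Ck oU _ (CkM oU (@Ck_cst k R U (-1)) (CkM oU (CkM oU sV sV) (Df v)))) => x Ux.
rewrite deriveV ?f0//; last exact: diff_derivable (df x Ux).
by rewrite /= mulN1r /GRing.scale/= mulNr expr2 invfM.
Qed.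

Lemma smoothV U (f : V -> R) : open U -> (forall x, U x -> f x != 0) ->
  smooth_on U f -> smooth_on U (fun x => (f x)^-1).
Proof.
by move=> oU f0 /smooth_onP sf; apply/smooth_onP => k; exact: CkV (sf k).
Qed.

Lemma smooth_linear W U (f : {linear V -> W}) : continuous f -> smooth_on U f.
Proof.
move=> cf; apply/smooth_onP => -[|k]; (split=> [x _|//]; first exact: linear_differentiable) => v.
rewrite (_ : 'D_v _ = cst (f v)); first exact: Ck_cst.
by apply/funext => x; rewrite deriveE ?diff_lin//; exact: linear_differentiable.
Qed.

Lemma smooth_det U n (A : V -> 'M[R]_n) : open U ->
  (forall i j, smooth_on U (fun x => A x i j)) -> smooth_on U (fun x => \det (A x)).
Proof.
move=> oU sA; apply: smooth_sum => // s _; apply: smoothM => //.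
  exact: smooth_cst.
exact: smooth_prod.
Qed.

(** Cramer's rule: an entry of the inverse is a cofactor over the determinant, both polynomial in
    the entries of [A]. *)
Lemma smooth_invmx U n (A : V -> 'M[R]_n) i j : open U ->
  (forall x, U x -> A x \in unitmx) ->
  (forall i j, smooth_on U (fun x => A x i j)) ->
  smooth_on U (fun x => invmx (A x) i j).
Proof.
move=> oU uA sA.
apply: (@eq_smooth _ _ (fun x => (\det (A x))^-1 * cofactor (A x) j i)) => //.
  by move=> x Ux; rewrite /invmx uA// !mxE.
apply: smoothM => //.
  apply: smoothV (smooth_det oU sA) => // x /uA; by rewrite unitmxE unitfE.
apply: smoothM => //; first exact: smooth_cst.
apply: smooth_det => // k l; rewrite (_ : (fun=> _) = fun x => A x (lift j k) (lift i l)) //.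
by apply/funext => x; rewrite !mxE.
Qed.

Lemma smooth_coord U m n (A : V -> 'M[R]_(m, n)) i j : open U ->
  smooth_on U A -> smooth_on U (fun x => A x i j).
Proof.
move=> oU /smooth_onP sA; apply/smooth_onP => k; move: sA => /(_ k).
have dA x (B : V -> 'M[R]_(m, n)) : differentiable B x -> differentiable (fun x => B x i j) x.
  move=> dB; apply: (@differentiable_comp _ _ _ _ B (fun N : 'M[R]_(m, n) => N i j)) => //.
  exact: differentiable_coord.
elim: k A => [|k IH] A [df Df]; (split=> [x Ux|//]; first exact: dA (df _ Ux)) => v.
apply: eq_Ck (IH _ (Df v)) => // x Ux.
by rewrite derive_mx ?mxE//; apply: diff_derivable; exact: df.
Qed.

End Smooth.

(** An affine map has constant differential, so iterated derivatives of the composite along [s] are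
    those of [f] along [map iota s]; the difference quotients already coincide. *)
Lemma smooth_line (R : realType) (V W X : normedModType R) (U : set V) (f : V -> X)
    (iota : {linear W -> V}) (a : V) :
  continuous iota -> smooth_on U f ->
  smooth_on [set y | U (iota y + a)] (fun y => f (iota y + a)).
Proof.
move=> ci sf s y Uy.
have dia : differentiable (fun y => iota y + a) y.
  apply: (@differentiableD _ _ _ iota (cst a)); last exact: differentiable_cst.
  exact: linear_differentiable.
have -> : foldr (fun v h => 'D_v h) (fun y => f (iota y + a)) s
   = (foldr (fun v h => 'D_v h) f (map iota s)) \o (fun y => iota y + a).
  elim: s => [|v s IH] //=; rewrite IH; apply/funext => z /=.
  set g := foldr _ _ _; rewrite /derive.
  suff -> : (fun h : R => h^-1 *: (((g \o (fun y => iota y + a)) \o shift z) (h *: v)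
      - (g \o (fun y => iota y + a)) z)) =
    (fun h => h^-1 *: ((g \o shift (iota z + a)) (h *: iota v) - g (iota z + a))) by [].
  apply/funext => h; congr (_ *: (g _ - _)).
  by rewrite -[LHS]/(iota (h *: v + z) + a) linearD linearZ -addrA.
by apply: (@differentiable_comp _ _ _ _ (fun y => iota y + a)) => //; exact: sf.
Qed.

(** * Changes of charts *)

Lemma row_basis (R : realType) n (v : 'rV[R]_n) :
  v = \sum_(a < n) v ord0 a *: basis_vec R a.
Proof. by rewrite [LHS]row_sum_delta. Qed.

Lemma derive_rowE (R : realType) n (W : normedModType R) (f : 'rV[R]_n -> W) x v :
  differentiable f x ->
  'D_v f x = \sum_(a < n) v ord0 a *: 'D_(basis_vec R a) f x.
Proof.
move=> df; rewrite deriveE// [v in LHS]row_basis linear_sum.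
by apply: eq_bigr => a _; rewrite linearZ deriveE.
Qed.

Lemma derive_pairE (R : realType) n (f : 'rV[R]_n * 'rV[R]_n -> R) z u :
  differentiable f z ->
  'D_u f z = \sum_(a < n) u.1 ord0 a * pdx a f z
             + \sum_(a < n) u.2 ord0 a * pdv a f z.
Proof.
move=> df; rewrite /pdx /pdv.
have E1 : (u.1, 0) = \sum_(a < n) u.1 ord0 a *: (basis_vec R a, 0 : 'rV[R]_n).
  rewrite {1}(row_basis u.1); elim/big_rec2: _ => // a x y _ <-.
  by congr pair; rewrite /= scaler0 addr0.
have E2 : (0, u.2) = \sum_(a < n) u.2 ord0 a *: (0 : 'rV[R]_n, basis_vec R a).
  rewrite {1}(row_basis u.2); elim/big_rec2: _ => // a x y _ <-.
  by congr pair; rewrite /= scaler0 addr0.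
have -> : u = (u.1, 0) + (0, u.2).
  by case: u {E1 E2} => u1 u2; congr pair; rewrite /= ?addr0 ?add0r.
rewrite deriveE// linearD /= addr0 add0r E1 E2 !linear_sum /=.
by congr (_ + _); apply: eq_bigr => a _; rewrite linearZ deriveE.
Qed.

Section Charts.
Variables (R : realType) (n : nat) (M : manifold R n).
Implicit Types (c : chart R n M) (W : set (tangent M)).

Lemma cimgP c x : cimg c x -> cdom c (cinv c x) /\ cmap c (cinv c x) = x.
Proof. by move=> [p cp <-]; rewrite cmapK. Qed.

Lemma transition_img c c' x : transition_dom c c' x ->
  cimg c' (transition c c' x) /\ cinv c' (transition c c' x) = cinv c x.
Proof.
move=> [cx c'x]; split; first by exists (cinv c x).
by rewrite /transition/= cmapK.
Qed.

Lemma transition_comp c c' c'' x : transition_dom c c' x ->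
  transition c' c'' (transition c c' x) = transition c c'' x.
Proof. by move=> /transition_img[_ e]; rewrite {1}/transition/= e. Qed.

Lemma transition_dom_comp c c' c'' x : transition_dom c c' x ->
  transition_dom c c'' x -> transition_dom c' c'' (transition c c' x).
Proof. by move=> /transition_img[? e] [_ ?]; split; rewrite ?e. Qed.

Lemma transition_dom_refl c x : cimg c x -> transition_dom c c x.
Proof. by move=> cx; split=> //; have [] := cimgP cx. Qed.

Lemma transition_dom_sym c c' x : transition_dom c c' x ->
  transition_dom c' c (transition c c' x).
Proof.
by move=> cc; apply: transition_dom_comp => //; apply: transition_dom_refl; case: cc.
Qed.

Lemma transition_id c x : cimg c x -> transition c c x = x.
Proof. by move=> /cimgP[]. Qed.

Lemma transitionK c c' x : transition_dom c c' x ->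
  transition c' c (transition c c' x) = x.
Proof. by move=> cc; rewrite (transition_comp _ cc) transition_id//; case: cc. Qed.

Lemma transition_dom_open c c' : open (transition_dom c c').
Proof.
rewrite openE => x [cx c'x].
have cc : {for x, continuous (cinv c)}.
  have := @cinv_continuous _ _ _ c.
  rewrite continuous_open_subspace; last exact: cimg_open.
  by apply; rewrite inE.
have nx := open_nbhs_nbhs (conj (@cimg_open _ _ _ c) cx).
have := cc _ (open_nbhs_nbhs (conj (@cdom_open _ _ _ c') c'x)).
by rewrite nbhs_simpl; apply: filterS2 nx => y.
Qed.

Lemma transition_smooth c c' : atlas c -> atlas c' ->
  smooth_on (transition_dom c c') (transition c c').
Proof. exact: atlas_smooth. Qed.

Lemma transition_differentiable c c' x : atlas c -> atlas c' ->
  transition_dom c c' x -> differentiable (transition c c') x.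
Proof. by move=> ac ac'; exact/smooth_differentiable/atlas_smooth. Qed.

(** Chain rule applied to the cocycle identity, which holds near [x] because transition domains are
    open. *)
Lemma derive_transition_comp c c' c'' x v : atlas c -> atlas c' -> atlas c'' ->
  transition_dom c c' x -> transition_dom c c'' x ->
  'D_('D_v (transition c c') x) (transition c' c'') (transition c c' x)
    = 'D_v (transition c c'') x.
Proof.
move=> ac ac' ac'' cc' cc''; rewrite -derive_comp; last 2 first.
- exact: transition_differentiable.
- by apply: transition_differentiable => //; exact: transition_dom_comp.
apply: near_eq_derive.
apply: filterS (open_nbhs_nbhs (conj (@transition_dom_open c c') cc')) => y.
exact: transition_comp.
Qed.

Lemma derive_transition_id c x v : cimg c x -> 'D_v (transition c c) x = v.
Proof.
move=> cx; rewrite -[RHS](derive_id x v); apply: near_eq_derive.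
by apply: filterS (open_nbhs_nbhs (conj (@cimg_open _ _ _ c) cx)) => y /transition_id.
Qed.

Lemma derive_transitionK c c' x v : atlas c -> atlas c' -> transition_dom c c' x ->
  'D_('D_v (transition c c') x) (transition c' c) (transition c c' x) = v.
Proof.
move=> ac ac' cc'; have [cx _] := cc'.
by rewrite derive_transition_comp// ?derive_transition_id//; exact: transition_dom_refl.
Qed.

Definition tangent_transition c c' (z : 'rV[R]_n * 'rV[R]_n) :=
  (transition c c' z.1, 'D_(z.2) (transition c c') z.1).

Lemma transition_dom_chart_at c x : cimg c x ->
  transition_dom c (chart_at (cinv c x)) x.
Proof. by move=> cx; split=> //; exact: chart_at_dom. Qed.

Lemma tvecE c z : atlas c -> cimg c z.1 ->
  tvec c z = (cinv c z.1, 'D_(z.2) (transition c (chart_at (cinv c z.1))) z.1).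
Proof.
move=> ac cz; rewrite /tvec deriveE//; apply: transition_differentiable => //.
  exact: chart_at_atlas.
exact: transition_dom_chart_at.
Qed.

(** Vectors are stored by components in the preferred chart of their base point, so both sides are
    read in that third chart, where the differentiated cocycle identity applies. *)
Lemma tvec_transition c c' z : atlas c -> atlas c' -> transition_dom c c' z.1 ->
  tvec c' (tangent_transition c c' z) = tvec c z.
Proof.
move=> ac ac' cc'; have [cz _] := cc'; have [c'z e] := transition_img cc'.
rewrite !tvecE//= e derive_transition_comp//; first exact: chart_at_atlas.
exact: transition_dom_chart_at.
Qed.

Lemma tset_fiber W c x : atlas c -> cimg c x -> (forall p, exists v, W (p, v)) ->
  exists v, tset c W (x, v).
Proof.
move=> ac cx /(_ (cinv c x))[w Ww].
have cd := transition_dom_chart_at cx; have ca := chart_at_atlas (cinv c x).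
(* [w] has components in the preferred chart; its components in [c] come from the differential of
   the reverse transition. *)
exists ('D_w (transition (chart_at (cinv c x)) c) (transition c (chart_at (cinv c x)) x)).
split=> //; rewrite tvecE//=.
have := derive_transitionK w ca ac (transition_dom_sym cd).
by rewrite transitionK// => ->.
Qed.

End Charts.

(** * Derivatives of sums, products, pairs and quadratic forms *)

Section DerivativeRules.
Variable R : realType.
Implicit Types V W : normedModType R.

Lemma differentiable_sumE V W (I : Type) (r : seq I) (F : I -> V -> W) x :
  (forall i, differentiable (F i) x) ->
  differentiable (fun y => \sum_(i <- r) F i y) x.
Proof.
move=> dF; elim: r => [|i r IH].
  rewrite (_ : (fun=> _) = cst 0); first exact: differentiable_cst.
  by apply/funext => y; rewrite big_nil.
rewrite (_ : (fun=> _) = F i \+ fun y => \sum_(i <- r) F i y).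
  exact: differentiableD.
by apply/funext => y; rewrite big_cons.
Qed.

Lemma derive_sumE V W (I : Type) (r : seq I) (F : I -> V -> W) x v :
  (forall i, differentiable (F i) x) ->
  'D_v (fun y => \sum_(i <- r) F i y) x = \sum_(i <- r) 'D_v (F i) x.
Proof.
move=> dF; elim: r => [|i r IH].
  rewrite big_nil (_ : (fun=> _) = cst 0) ?derive_cst//.
  by apply/funext => y; rewrite big_nil.
rewrite big_cons -IH -deriveD; last 2 first.
- exact: diff_derivable.
- by apply: diff_derivable; exact: differentiable_sumE.
by congr ('D_v _ x); apply/funext => y; rewrite big_cons.
Qed.

Lemma derive_mulE V (f g : V -> R) x v : differentiable f x -> differentiable g x ->
  'D_v (fun y => f y * g y) x = 'D_v f x * g x + f x * 'D_v g x.
Proof.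
move=> df dg; rewrite addrC (mulrC ('D_v f x)).
by rewrite [LHS](deriveM (diff_derivable df) (diff_derivable dg)).
Qed.

Lemma derive_pair V W W' (f : V -> W) (g : V -> W') x v :
  differentiable f x -> differentiable g x ->
  'D_v (fun y => (f y, g y)) x = ('D_v f x, 'D_v g x).
Proof.
move=> df dg; rewrite !deriveE//; last exact: differentiable_pair.
by rewrite diff_pair.
Qed.

Lemma differentiable_row V n (f : V -> 'rV[R]_n) x :
  (forall a, differentiable (fun y => f y ord0 a) x) -> differentiable f x.
Proof.
move=> df; rewrite (_ : f = \sum_(a < n) (fun y => f y ord0 a *: basis_vec R a)).
  by apply: differentiable_sum => a; exact: differentiableZl.
by apply/funext => y; rewrite fct_sumE {1}(row_basis (f y)).
Qed.

Lemma derive_row V n (f : V -> 'rV[R]_n) x v a : differentiable f x ->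
  'D_v (fun y => f y ord0 a) x = ('D_v f x) ord0 a.
Proof. by move=> df; rewrite [in RHS]derive_mx ?mxE//; exact: diff_derivable. Qed.

Lemma differentiable_row_coord n (x : 'rV[R]_n) a :
  differentiable (fun w : 'rV[R]_n => w ord0 a) x.
Proof. exact: differentiable_coord. Qed.

Lemma derive_row_coord n (x v : 'rV[R]_n) a :
  'D_v (fun w : 'rV[R]_n => w ord0 a) x = v ord0 a.
Proof. by rewrite derive_row ?derive_id. Qed.

Lemma pdvE n (f : 'rV[R]_n * 'rV[R]_n -> R) (x v : 'rV[R]_n) a :
  pdv a f (x, v) = 'D_(basis_vec R a) (fun w => f (x, w)) v.
Proof.
rewrite /pdv /derive; set F := (X in lim (X @ _)); set G := (X in _ = lim (X @ _)).
suff -> : F = G by [].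
apply/funext => h; rewrite /F /G /=; congr (_ *: (f _ - _)).
by congr pair; rewrite /= scaler0 add0r.
Qed.

Lemma sum_basis_vec n a (F : 'I_n -> R) :
  \sum_(e < n) basis_vec R a ord0 e * F e = F a.
Proof.
rewrite (bigD1 a)//= big1 ?addr0; first by rewrite mxE !eqxx mul1r.
by move=> e /negPf ea; rewrite mxE ea andbF mul0r.
Qed.

(** Polarization by differentiation. The Hessian retains only the symmetric part of [B], so
    recovering [B] itself requires its symmetry from elsewhere. *)
Lemma derive2_quadratic n (B : 'I_n -> 'I_n -> R) (v : 'rV[R]_n) b d :
  'D_(basis_vec R b) ('D_(basis_vec R d)
     (fun w : 'rV[R]_n => \sum_(e < n) \sum_(f < n) B e f * w ord0 e * w ord0 f)) v
  = B b d + B d b.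
Proof.
have dc := @differentiable_row_coord n.
have dk : forall k e (x : 'rV[R]_n),
    differentiable (fun w : 'rV[R]_n => k * w ord0 e) x.
  by move=> k e x; apply: (@differentiableM _ _ (cst k)) => //; exact: differentiable_cst.
have dke k e (x u : 'rV[R]_n) :
    'D_u (fun w : 'rV[R]_n => k * w ord0 e) x = k * u ord0 e.
  rewrite (derive_mulE _ (differentiable_cst k x) (dc x e)) derive_row_coord.
  by rewrite derive_cst mul0r add0r.
have db e f (x : 'rV[R]_n) :
    differentiable (fun w : 'rV[R]_n => B e f * w ord0 e * w ord0 f) x.
  exact: differentiableM.
have -> : 'D_(basis_vec R d)
     (fun w : 'rV[R]_n => \sum_(e < n) \sum_(f < n) B e f * w ord0 e * w ord0 f)
   = fun w => \sum_(e < n) (B d e + B e d) * w ord0 e.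
  apply/funext => w; rewrite derive_sumE; last by move=> e; exact: differentiable_sumE.
  under eq_bigr => e _.
    rewrite derive_sumE//.
    under eq_bigr => f _ do rewrite derive_mulE// dke derive_row_coord.
    rewrite big_split/=.
    over.
  rewrite big_split/=; under [RHS]eq_bigr => e _ do rewrite mulrDl.
  rewrite [RHS]big_split/=; congr (_ + _).
    rewrite exchange_big/=; apply: eq_bigr => f _.
    rewrite -[RHS](sum_basis_vec d (fun e => B e f * w ord0 f)).
    by apply: eq_bigr => e _; ring.
  apply: eq_bigr => e _.
  rewrite -[RHS](sum_basis_vec d (fun f => B e f * w ord0 e)).
  by apply: eq_bigr => f _; ring.
rewrite derive_sumE// -(sum_basis_vec b (fun e => B e d + B d e)).
by apply: eq_bigr => e _; rewrite dke; ring.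
Qed.

End DerivativeRules.

Section ProductRules.
Variables (R : realType) (V W X : normedModType R).

Lemma differentiable_fst (z : V * W) : differentiable (fst : V * W -> V) z.
Proof. by apply: linear_differentiable => x; exact: cvg_fst. Qed.

Lemma differentiable_snd (z : V * W) : differentiable (snd : V * W -> W) z.
Proof. by apply: linear_differentiable => x; exact: cvg_snd. Qed.

Lemma derive_fst (z u : V * W) : 'D_u (fst : V * W -> V) z = u.1.
Proof.
rewrite deriveE; last exact: differentiable_fst.
by rewrite diff_lin// => x; exact: cvg_fst.
Qed.

Lemma derive_snd (z u : V * W) : 'D_u (snd : V * W -> W) z = u.2.
Proof.
rewrite deriveE; last exact: differentiable_snd.
by rewrite diff_lin// => x; exact: cvg_snd.
Qed.

Lemma differentiable_comp_fst (f : V -> X) (z : V * W) :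
  differentiable f z.1 -> differentiable (fun z : V * W => f z.1) z.
Proof.
by move=> df; apply: (@differentiable_comp _ _ _ _ fst f) => //; exact: differentiable_fst.
Qed.

Lemma derive_comp_fst (f : V -> X) (z u : V * W) : differentiable f z.1 ->
  'D_u (fun z : V * W => f z.1) z = 'D_(u.1) f z.1.
Proof.
move=> df; rewrite -[in RHS](derive_fst z u).
by apply: (@derive_comp _ _ _ _ fst f) => //; exact: differentiable_fst.
Qed.

Lemma differentiable_comp_snd (f : W -> X) (z : V * W) :
  differentiable f z.2 -> differentiable (fun z : V * W => f z.2) z.
Proof.
by move=> df; apply: (@differentiable_comp _ _ _ _ snd f) => //; exact: differentiable_snd.
Qed.

Lemma derive_comp_snd (f : W -> X) (z u : V * W) : differentiable f z.2 ->
  'D_u (fun z : V * W => f z.2) z = 'D_(u.2) f z.2.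
Proof.
move=> df; rewrite -[in RHS](derive_snd z u).
by apply: (@derive_comp _ _ _ _ snd f) => //; exact: differentiable_snd.
Qed.

End ProductRules.

(** * Derivatives of the induced coordinate change on the tangent bundle *)

Section TransitionDerivatives.
Variables (R : realType) (n : nat) (M : manifold R n).
Variables (c c' : chart R n M).
Hypotheses (ac : atlas c) (ac' : atlas c').

Local Notation e_ := (basis_vec R).
Local Notation phi := (transition c c').
Local Notation Phi := (tangent_transition c c').

(* With the row-vector convention this is the transpose of the usual Jacobian
   matrix d phi^a / d x^q. *)
Definition transition_mx (x : 'rV[R]_n) : 'M[R]_n :=
  \matrix_(q, a) 'D_(e_ q) phi x ord0 a.

Definition transition_hess (x : 'rV[R]_n) (q m a : 'I_n) : R :=
  'D_(e_ q) ('D_(e_ m) phi) x ord0 a.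

Lemma transition_mx_differentiable x q a : transition_dom c c' x ->
  differentiable (fun y => transition_mx y q a) x.
Proof.
move=> cx; have := smooth_coord ord0 a (@transition_dom_open _ _ _ c c')
  (smooth_derive (e_ q) (transition_smooth ac ac')).
by move=> /smooth_differentiable/(_ cx); apply: near_eq_differentiable; near=> y; rewrite mxE.
Unshelve. all: by end_near. Qed.

Lemma derive_transition_mx x q m a : transition_dom c c' x ->
  'D_(e_ q) (fun y => transition_mx y m a) x = transition_hess x q m a.
Proof.
move=> cx; have dD := smooth_differentiable (smooth_derive (e_ m) (transition_smooth ac ac')) cx.
rewrite /transition_hess -derive_row//; apply: near_eq_derive; near=> y; exact: mxE.
Unshelve. all: by end_near. Qed.

Lemma transition_hessC x q m a : transition_dom c c' x ->
  transition_hess x q m a = transition_hess x m q a.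
Proof.
move=> cx; have oD := @transition_dom_open _ _ _ c c'.
have sphi := transition_smooth ac ac'.
have nD : \near x, transition_dom c c' x by exact: open_nbhs_nbhs.
(* [derive_swap] concerns real-valued functions, so it is applied to the component [a] of phi. *)
have E p y : transition_dom c c' y ->
    'D_(e_ p) (fun x => phi x ord0 a) y = ('D_(e_ p) phi y) ord0 a.
  by move=> cy; apply: derive_row; exact: smooth_differentiable cy.
have H p r : transition_hess x p r a = 'D_(e_ p) ('D_(e_ r) (fun x => phi x ord0 a)) x.
  rewrite /transition_hess -derive_row; last first.
    exact: (smooth_differentiable (smooth_derive _ sphi) cx).
  by apply: near_eq_derive; apply: filterS nD => y /E.
have sa := smooth_coord ord0 a oD sphi.
rewrite !H; apply: derive_swap; last 2 first.
- exact: smooth_differentiable (smooth_derive _ sa) cx.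
- exact: smooth_differentiable (smooth_derive _ sa) cx.
by apply: filterS nD => y; exact: smooth_differentiable.
Qed.

Lemma tangent_transition2E z a : transition_dom c c' z.1 ->
  (Phi z).2 ord0 a = \sum_(m < n) z.2 ord0 m * transition_mx z.1 m a.
Proof.
move=> cz; rewrite /= derive_rowE; last exact: transition_differentiable.
by rewrite summxE; apply: eq_bigr => m _; rewrite !mxE.
Qed.

Lemma tangent_transition_near (z : 'rV[R]_n * 'rV[R]_n) : transition_dom c c' z.1 ->
  \forall z' \near z, transition_dom c c' z'.1.
Proof.
move=> cz; have := open_nbhs_nbhs (conj (@transition_dom_open _ _ _ c c') cz).
exact: (@cvg_fst _ _ (nbhs z.1) (nbhs z.2)).
Qed.

Let dsnd m (z : 'rV[R]_n * 'rV[R]_n) :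
  differentiable (fun z : 'rV[R]_n * 'rV[R]_n => z.2 ord0 m) z.
Proof.
apply: (@differentiable_comp_snd _ _ _ _ (fun w : 'rV[R]_n => w ord0 m)).
exact: differentiable_row_coord.
Qed.

Let dmx m a (z : 'rV[R]_n * 'rV[R]_n) : transition_dom c c' z.1 ->
  differentiable (fun z : 'rV[R]_n * 'rV[R]_n => transition_mx z.1 m a) z.
Proof.
move=> cz; apply: (@differentiable_comp_fst _ _ _ _ (fun y => transition_mx y m a)).
exact: transition_mx_differentiable.
Qed.

Let dcoord z m a : transition_dom c c' z.1 ->
  differentiable (fun z : 'rV[R]_n * 'rV[R]_n => z.2 ord0 m * transition_mx z.1 m a) z.
Proof.
by move=> cz; apply: differentiableM => //; exact: dmx.
Qed.

(** The velocity part differentiates phi in a direction that itself varies with [z]; written with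
    the Jacobian it becomes a sum of products of differentiable functions. *)
Lemma tangent_transition_differentiable z : transition_dom c c' z.1 ->
  differentiable Phi z.
Proof.
move=> cz; apply: differentiable_pair.
  by apply: differentiable_comp_fst; exact: transition_differentiable.
apply: differentiable_row => a.
apply: (@near_eq_differentiable _ _ _
    (fun z : 'rV[R]_n * 'rV[R]_n => \sum_(m < n) z.2 ord0 m * transition_mx z.1 m a)).
  by apply: filterS (tangent_transition_near cz) => y /tangent_transition2E.
by apply: differentiable_sumE => m; exact: dcoord.
Qed.

(** Only [u.1] moves the base point and so differentiates the Jacobian: this is where all Hessian
    terms originate. *)
Lemma derive_tangent_transition z u : transition_dom c c' z.1 ->
  'D_u Phi z = ('D_(u.1) phi z.1,
    \row_a \sum_(m < n) (u.2 ord0 m * transition_mx z.1 m a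
       + z.2 ord0 m * 'D_(u.1) (fun y => transition_mx y m a) z.1)).
Proof.
move=> cz; have dP := tangent_transition_differentiable cz.
have d1 : differentiable (fun z => (Phi z).1) z.
  by apply: differentiable_comp_fst; exact: transition_differentiable.
have d2 : differentiable (fun z => (Phi z).2) z.
  by apply: (@differentiable_comp _ _ _ _ Phi snd) => //; exact: differentiable_snd.
rewrite [LHS](derive_pair u d1 d2); congr pair.
apply/rowP => a; rewrite -derive_row// mxE.
transitivity ('D_u (fun z : 'rV[R]_n * 'rV[R]_n => \sum_(m < n) z.2 ord0 m * transition_mx z.1 m a) z).
  by apply: near_eq_derive; apply: filterS (tangent_transition_near cz) => y /tangent_transition2E.
rewrite derive_sumE; last by move=> m; exact: dcoord.
apply: eq_bigr => m _; rewrite derive_mulE//; last exact: dmx.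
rewrite (@derive_comp_snd _ _ _ _ (fun w : 'rV[R]_n => w ord0 m)); last first.
  exact: differentiable_row_coord.
rewrite derive_row_coord.
rewrite (@derive_comp_fst _ _ _ _ (fun y => transition_mx y m a))//.
exact: transition_mx_differentiable.
Qed.

Variable h : 'rV[R]_n * 'rV[R]_n -> R.

Lemma pdv_comp_tangent_transition z q : transition_dom c c' z.1 ->
  differentiable h (Phi z) ->
  pdv q (h \o Phi) z = \sum_(a < n) transition_mx z.1 q a * pdv a h (Phi z).
Proof.
move=> cz dh; rewrite [LHS]derive_comp//; last exact: tangent_transition_differentiable.
rewrite derive_tangent_transition// derive_pairE//= derive0 big1 ?add0r; last first.
  by move=> a _; rewrite mxE mul0r.
apply: eq_bigr => a _; rewrite mxE; congr (_ * _).
under eq_bigr => m _ do rewrite derive0 mulr0 addr0.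
by rewrite sum_basis_vec.
Qed.

Lemma pdx_comp_tangent_transition z q : transition_dom c c' z.1 ->
  differentiable h (Phi z) ->
  pdx q (h \o Phi) z = \sum_(a < n) transition_mx z.1 q a * pdx a h (Phi z)
   + \sum_(a < n) (\sum_(m < n) z.2 ord0 m * transition_hess z.1 q m a)
       * pdv a h (Phi z).
Proof.
move=> cz dh; rewrite [LHS]derive_comp//; last exact: tangent_transition_differentiable.
rewrite derive_tangent_transition// derive_pairE//=; congr (_ + _).
  by apply: eq_bigr => a _; rewrite mxE.
apply: eq_bigr => a _; rewrite mxE; congr (_ * _).
by apply: eq_bigr => m _; rewrite mxE mul0r add0r derive_transition_mx.
Qed.

End TransitionDerivatives.

(** * Transformation of the spray *)

(** Here [v] is the velocity, [T] and [H] the Jacobian and Hessian of phi, [P] and [X] the velocity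
    and position derivatives of L in the new chart, [PX] and [PV] those of [P]. The two terms in [P]
    cancel by symmetry of [H]; the surviving Hessian term is multiplied by [PV], hence by the
    L-metric. *)
Lemma euler_lagrange_algebra (R : comPzRingType) n (v : 'I_n -> R) (T : 'I_n -> 'I_n -> R)
    (H : 'I_n -> 'I_n -> 'I_n -> R) (P X : 'I_n -> R) (PX PV : 'I_n -> 'I_n -> R) q :
  (forall q m a, H q m a = H m q a) ->
  \sum_(m < n) v m * (\sum_(a < n) (H m q a * P a + T q a *
      (\sum_(b < n) T m b * PX b a + \sum_(b < n) (\sum_(k < n) v k * H m k b) * PV b a)))
  - (\sum_(a < n) T q a * X a + \sum_(a < n) (\sum_(m < n) v m * H q m a) * P a)
  = \sum_(a < n) T q a * (\sum_(b < n) (\sum_(m < n) v m * T m b) * PX b a - X a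
      + \sum_(b < n) (\sum_(m < n) \sum_(k < n) v m * v k * H m k b) * PV b a).
Proof.
move=> sH.
rewrite (eq_bigr (fun m => \sum_(a < n) (v m * (H m q a * P a)
   + T q a * (v m * (\sum_(b < n) T m b * PX b a)
     + v m * (\sum_(b < n) (\sum_(k < n) v k * H m k b) * PV b a))))); last first.
  by move=> m _; rewrite mulr_sumr; apply: eq_bigr => a _; ring.
rewrite exchange_big/=; apply/eqP; rewrite subr_eq; apply/eqP.
rewrite -!big_split/=; apply: eq_bigr => a _.
rewrite big_split/= -mulr_sumr big_split/=.
have -> : \sum_(m < n) v m * (H m q a * P a) = (\sum_(m < n) v m * H q m a) * P a.
  by rewrite mulr_suml; apply: eq_bigr => m _; rewrite sH mulrA.
have -> : \sum_(m < n) v m * (\sum_(b < n) T m b * PX b a)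
  = \sum_(b < n) (\sum_(m < n) v m * T m b) * PX b a.
  under eq_bigr do rewrite mulr_sumr.
  rewrite exchange_big/=; apply: eq_bigr => b _.
  by rewrite mulr_suml; apply: eq_bigr => m _; rewrite mulrA.
have -> : \sum_(m < n) v m * (\sum_(b < n) (\sum_(k < n) v k * H m k b) * PV b a)
  = \sum_(b < n) (\sum_(m < n) \sum_(k < n) v m * v k * H m k b) * PV b a.
  under eq_bigr do rewrite mulr_sumr.
  rewrite exchange_big/=; apply: eq_bigr => b _.
  rewrite mulr_suml; apply: eq_bigr => m _; rewrite mulrA mulr_sumr.
  by congr (_ * _); apply: eq_bigr => k _; rewrite mulrA.
ring.
Qed.

Section SprayTransition.
Variables (R : realType) (n : nat) (M : manifold R n) (F : finsler_spacetime M).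
Variables (c c' : chart R n M).
Hypotheses (ac : atlas c) (ac' : atlas c').

Local Notation e_ := (basis_vec R).
Local Notation phi := (transition c c').
Local Notation Phi := (tangent_transition c c').
Local Notation T := (transition_mx c c').
Local Notation H := (transition_hess c c').
Local Notation f := (in_chart (fs_L F) c).
Local Notation f' := (in_chart (fs_L F) c').

Lemma tset_open d : atlas d -> open (tset d (fs_dom F)).
Proof. by move=> ad; have [_ + _ _ _] := fs_dom_conic F; exact. Qed.

Lemma in_chart_smooth d : atlas d ->
  smooth_on (tset d (fs_dom F)) (in_chart (fs_L F) d).
Proof. exact: fs_smooth. Qed.

Lemma tset_transition W z : tset c W z -> transition_dom c c' z.1 ->
  tset c' W (Phi z).
Proof.
move=> [_ Wz] cz; split; first by have [] := transition_img cz.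
by rewrite tvec_transition.
Qed.

Lemma in_chart_transition (L : tangent M -> R) z : transition_dom c c' z.1 ->
  in_chart L c z = (in_chart L c' \o Phi) z.
Proof. by move=> cz; rewrite /in_chart/= tvec_transition. Qed.

Lemma overlap_near z : tset c (fs_dom F) z -> transition_dom c c' z.1 ->
  \near z, tset c (fs_dom F) z /\ transition_dom c c' z.1.
Proof.
move=> tz cz; have := open_nbhs_nbhs (conj (tset_open ac) tz).
by apply: filterS2 (tangent_transition_near cz).
Qed.

Let diff_at (g : 'rV[R]_n * 'rV[R]_n -> R) z :
  smooth_on (tset c' (fs_dom F)) g -> tset c (fs_dom F) z ->
  transition_dom c c' z.1 -> differentiable g (Phi z).
Proof. by move=> sg tz cz; exact: smooth_differentiable sg (tset_transition tz cz). Qed.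

Lemma pdv_in_chart z q : tset c (fs_dom F) z -> transition_dom c c' z.1 ->
  pdv q f z = \sum_(a < n) T z.1 q a * pdv a f' (Phi z).
Proof.
move=> tz cz; rewrite -pdv_comp_tangent_transition//; last first.
  exact: diff_at (in_chart_smooth ac') tz cz.
by apply: near_eq_derive; apply: filterS (tangent_transition_near cz) => y; exact: in_chart_transition.
Qed.

Lemma pdx_in_chart z q : tset c (fs_dom F) z -> transition_dom c c' z.1 ->
  pdx q f z = \sum_(a < n) T z.1 q a * pdx a f' (Phi z)
    + \sum_(a < n) (\sum_(m < n) z.2 ord0 m * H z.1 q m a) * pdv a f' (Phi z).
Proof.
move=> tz cz; rewrite -pdx_comp_tangent_transition//; last first.
  exact: diff_at (in_chart_smooth ac') tz cz.
by apply: near_eq_derive; apply: filterS (tangent_transition_near cz) => y; exact: in_chart_transition.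
Qed.

Let derive_pdv z q u : tset c (fs_dom F) z -> transition_dom c c' z.1 ->
  'D_u (pdv q f) z = \sum_(a < n)
    ('D_(u.1) (fun y => T y q a) z.1 * pdv a f' (Phi z)
     + T z.1 q a * 'D_u (pdv a f' \o Phi) z).
Proof.
move=> tz cz.
have dT a : differentiable (fun y : 'rV[R]_n * 'rV[R]_n => T y.1 q a) z.
  apply: (@differentiable_comp_fst _ _ _ _ (fun y => T y q a)).
  exact: transition_mx_differentiable.
have dP a : differentiable (pdv a f' \o Phi) z.
  apply: differentiable_comp; first exact: tangent_transition_differentiable.
  by apply: diff_at => //; apply: smooth_derive; exact: in_chart_smooth.
transitivity ('D_u (fun y : 'rV[R]_n * 'rV[R]_n =>
    \sum_(a < n) T y.1 q a * (pdv a f' \o Phi) y) z).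
  apply: near_eq_derive; apply: filterS (overlap_near tz cz) => y [ty cy].
  exact: pdv_in_chart.
rewrite derive_sumE; last by move=> a; exact: differentiableM.
by apply: eq_bigr => a _; rewrite derive_mulE.
Qed.

(** Velocity directions leave the base point fixed, so the Jacobian is constant under the second
    derivative and no Hessian term appears. *)
Lemma L_metric_transition z : tset c (fs_dom F) z -> transition_dom c c' z.1 ->
  L_metric (fs_L F) c z = T z.1 *m L_metric (fs_L F) c' (Phi z) *m (T z.1)^T.
Proof.
move=> tz cz; apply/matrixP => p q; rewrite !mxE [pdv p _ _]derive_pdv//=.
rewrite mulr_sumr; apply: eq_bigr => a _; rewrite derive0 mul0r add0r.
have dP : differentiable (pdv a f') (Phi z).
  by apply: diff_at => //; apply: smooth_derive; exact: in_chart_smooth.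
have -> : 'D_(0, e_ p) (pdv a f' \o Phi) z
    = \sum_(b < n) T z.1 p b * pdv b (pdv a f') (Phi z).
  exact: pdv_comp_tangent_transition.
rewrite !mxE mulrCA mulrC; congr (_ * _); rewrite mulr_sumr.
by apply: eq_bigr => b _; rewrite !mxE; ring.
Qed.

(** The Euler-Lagrange covector without its acceleration term, which would be twice the L-metric
    applied to the acceleration; this omission is what spoils covariance. *)
Definition euler_lagrange (d : chart R n M) (z : 'rV[R]_n * 'rV[R]_n) (q : 'I_n) : R :=
  \sum_(m < n) z.2 ord0 m * pdx m (pdv q (in_chart (fs_L F) d)) z
  - pdx q (in_chart (fs_L F) d) z.

Lemma euler_lagrange_transition z q :
  tset c (fs_dom F) z -> transition_dom c c' z.1 ->
  euler_lagrange c z q = \sum_(a < n) T z.1 q a * (euler_lagrange c' (Phi z) a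
    + \sum_(b < n) (\sum_(m < n) \sum_(k < n) z.2 ord0 m * z.2 ord0 k * H z.1 m k b)
       * pdv b (pdv a f') (Phi z)).
Proof.
move=> tz cz; rewrite /euler_lagrange pdx_in_chart//.
have dP a : differentiable (pdv a f') (Phi z).
  by apply: diff_at => //; apply: smooth_derive; exact: in_chart_smooth.
have E m : pdx m (pdv q f) z = \sum_(a < n) (H z.1 m q a * pdv a f' (Phi z)
   + T z.1 q a * (\sum_(b < n) T z.1 m b * pdx b (pdv a f') (Phi z)
   + \sum_(b < n) (\sum_(k < n) z.2 ord0 k * H z.1 m k b) * pdv b (pdv a f') (Phi z))).
  rewrite [LHS]derive_pdv//; apply: eq_bigr => a _.
  rewrite derive_transition_mx//; congr (_ + _ * _).
  exact: pdx_comp_tangent_transition.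
under eq_bigr do rewrite E.
rewrite euler_lagrange_algebra; last by move=> *; exact: transition_hessC.
apply: eq_bigr => a _; congr (_ * (_ - _ + _)).
by apply: eq_bigr => b _; rewrite tangent_transition2E.
Qed.

End SprayTransition.

Section SprayLaw.
Variables (R : realType) (n : nat) (M : manifold R n) (F : finsler_spacetime M).
Implicit Types c : chart R n M.

Local Notation e_ := (basis_vec R).

Lemma transition_mx_inv c c' x : atlas c -> atlas c' -> transition_dom c c' x ->
  transition_mx c c' x *m transition_mx c' c (transition c c' x) = 1%:M.
Proof.
move=> ac ac' cx; apply/matrixP => q b; rewrite !mxE.
have := derive_transitionK (e_ q) ac ac' cx.
rewrite derive_rowE; last first.
  by apply: transition_differentiable => //; exact: transition_dom_sym.
move=> /matrixP/(_ ord0 b); rewrite mxE eqxx /= eq_sym => <-.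
by rewrite summxE; apply: eq_bigr => a _; rewrite !mxE.
Qed.

Lemma transition_mx_unit c c' x : atlas c -> atlas c' -> transition_dom c c' x ->
  transition_mx c c' x \in unitmx.
Proof. move=> ac ac' cx; exact: (mulmx1_unit (transition_mx_inv ac ac' cx)).1. Qed.

Lemma pdv_in_chartC c z a b : atlas c -> tset c (fs_dom F) z ->
  pdv b (pdv a (in_chart (fs_L F) c)) z = pdv a (pdv b (in_chart (fs_L F) c)) z.
Proof.
move=> ac tz; have sf := in_chart_smooth (F := F) ac.
have nz : \forall y \near z, tset c (fs_dom F) y.
  by apply: open_nbhs_nbhs; split; [exact: tset_open|].
apply: (@derive_swap _ _ (in_chart (fs_L F) c) z (0, e_ a) (0, e_ b)).
- apply: filterS nz => y ty.
  exact: smooth_differentiable sf ty.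
- exact: smooth_differentiable (smooth_derive _ sf) tz.
- exact: smooth_differentiable (smooth_derive _ sf) tz.
Qed.

Lemma invmx_congr (K : comUnitRingType) m (T g : 'M[K]_m) :
  T \in unitmx -> g \in unitmx -> T^T *m invmx (T *m g *m T^T) *m T = invmx g.
Proof.
move=> uT ug; set k := T *m g *m T^T.
have uk : k \in unitmx by rewrite !unitmx_mul unitmx_tr uT ug.
have gT : g *m (T^T *m invmx k *m T) = 1%:M.
  (* Moving the last factor [T] to the front turns the product into [k *m invmx k]. *)
  by rewrite !mulmxA; apply: mulmx1C; rewrite !mulmxA mulmxV.
by rewrite -[LHS](mulKmx ug) gT mulmx1.
Qed.

Lemma spray_transition c c' z a : atlas c -> atlas c' ->
  tset c (fs_dom F) z -> transition_dom c c' z.1 ->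
  \sum_(d < n) transition_mx c c' z.1 d a * spray F c d z
  = spray F c' a (tangent_transition c c' z)
    + 2^-1 * \sum_(m < n) \sum_(k < n) z.2 ord0 m * z.2 ord0 k * transition_hess c c' z.1 m k a.
Proof.
move=> ac ac' tz cz.
set T := transition_mx c c' z.1; set z' := tangent_transition c c' z.
have tz' : tset c' (fs_dom F) z' by exact: tset_transition.
set g' := L_metric (fs_L F) c' z'.
pose E d y : 'cV[R]_n := \col_q euler_lagrange F d y q.
pose Q : 'cV[R]_n := \col_a \sum_(m < n) \sum_(k < n) z.2 ord0 m * z.2 ord0 k
  * transition_hess c c' z.1 m k a.
have SE d y b : spray F d b y = (4^-1 *: (invmx (L_metric (fs_L F) d y) *m E d y)) b ord0.
  by rewrite !mxE /spray; congr (_ * _); apply: eq_bigr => q _; rewrite !mxE.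
(* The 2 undoes the 1/2 in the L-metric; combined with the 1/4 in the spray it yields the final
   coefficient 1/2. *)
have EE : E c z = T *m (E c' z' + 2 *: (g' *m Q)).
  apply/matrixP => q j; rewrite !mxE (euler_lagrange_transition ac ac')//.
  apply: eq_bigr => b _; rewrite !mxE; congr (_ * (_ + _)).
  rewrite mulr_sumr; apply: eq_bigr => k _; rewrite !mxE.
  rewrite (pdv_in_chartC k b ac' tz').
  by rewrite mulrA mulrA divff ?pnatr_eq0// mul1r mulrC.
have -> : \sum_(d < n) T d a * spray F c d z
    = (4^-1 *: (T^T *m (invmx (L_metric (fs_L F) c z) *m E c z))) a ord0.
  rewrite !mxE mulr_sumr; apply: eq_bigr => d _.
  by rewrite SE !mxE; ring.
rewrite (L_metric_transition ac ac')// -/T -/z' -/g' EE !mulmxA invmx_congr; last 2 first.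
- exact: transition_mx_unit.
- exact: fs_nondegenerate.
rewrite mulmxDr -scalemxAr mulmxA mulVmx; last exact: fs_nondegenerate.
rewrite mul1mx scalerDr scalerA mxE -SE !mxE; congr (_ + _ * _).
by field.
Qed.

End SprayLaw.

(** The left side is the defect of the connection law, at a fixed upper index, evaluated as a
    quadratic form at [w]; the right side is the form it takes in the spray law. Here [t] is a
    column of the Jacobian and [G'] the new coefficients with that upper index. *)
Lemma quadratic_transition_algebra (R : comPzRingType) n (w t : 'I_n -> R)
    (T H : 'I_n -> 'I_n -> R) (G : 'I_n -> 'I_n -> 'I_n -> R) (G' : 'I_n -> 'I_n -> R) :
  \sum_(e < n) \sum_(f < n) (\sum_(d < n) t d * G d e f - H e f
     - \sum_(b < n) \sum_(d < n) T e b * T f d * G' b d) * w e * w f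
  = \sum_(d < n) t d * (\sum_(e < n) \sum_(f < n) G d e f * w e * w f)
    - \sum_(e < n) \sum_(f < n) w e * w f * H e f
    - \sum_(b < n) \sum_(d < n) G' b d * (\sum_(e < n) w e * T e b) * (\sum_(f < n) w f * T f d).
Proof.
have -> : \sum_(d < n) t d * (\sum_(e < n) \sum_(f < n) G d e f * w e * w f)
    = \sum_(e < n) \sum_(f < n) (\sum_(d < n) t d * G d e f) * w e * w f.
  under eq_bigr do rewrite mulr_sumr.
  rewrite exchange_big/=; apply: eq_bigr => e _.
  under eq_bigr do rewrite mulr_sumr.
  rewrite exchange_big/=; apply: eq_bigr => f _.
  by rewrite !mulr_suml; apply: eq_bigr => d _; rewrite !mulrA.
have -> : \sum_(b < n) \sum_(d < n) G' b d * (\sum_(e < n) w e * T e b) * (\sum_(f < n) w f * T f d)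
    = \sum_(e < n) \sum_(f < n) (\sum_(b < n) \sum_(d < n) T e b * T f d * G' b d) * w e * w f.
  transitivity (\sum_(e < n) \sum_(b < n) \sum_(f < n) \sum_(d < n)
      T e b * T f d * G' b d * w e * w f); last first.
    apply: eq_bigr => e _; rewrite exchange_big/=; apply: eq_bigr => f _.
    rewrite !mulr_suml; apply: eq_bigr => b _.
    by rewrite !mulr_suml.
  rewrite [RHS]exchange_big/=; apply: eq_bigr => b _.
  under [RHS]eq_bigr do rewrite exchange_big/=.
  rewrite [RHS]exchange_big/=; apply: eq_bigr => d _.
  rewrite -mulrA mulr_suml mulr_sumr; apply: eq_bigr => e _.
  by rewrite !mulr_sumr; apply: eq_bigr => f _; ring.
rewrite -!sumrB; apply: eq_bigr => e _.
by rewrite -!sumrB; apply: eq_bigr => f _; ring.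
Qed.

(** * Symmetry and transformation law of the Berwald coefficients *)

Section Berwald.
Variables (R : realType) (n : nat) (M : manifold R n) (F : finsler_spacetime M).
Variable Gamma : coefficients M.
Hypothesis FG : berwald_with F Gamma.
Implicit Types c : chart R n M.

Local Notation e_ := (basis_vec R).

Lemma tset_fiber_near c x v : atlas c -> tset c (fs_dom F) (x, v) ->
  \forall w \near v, tset c (fs_dom F) (x, w).
Proof.
move=> ac txv.
have [[A B] [/= nA nB] AB] : nbhs (x, v) (tset c (fs_dom F)).
  by apply: open_nbhs_nbhs; split; [exact: tset_open|].
by apply: filterS nB => w Bw; apply: AB; split => //=; exact: nbhs_singleton.
Qed.

Lemma fs_fiber c x : atlas c -> cimg c x -> exists v, tset c (fs_dom F) (x, v).
Proof.
by move=> ac cx; apply: tset_fiber => //; have [] := fs_dom_conic F.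
Qed.

(* Gamma is a second derivative of the quadratic form (1/2) Gamma(w, w), hence
   equals its own symmetrization. *)
Lemma berwald_sym c x a b d : atlas c -> cimg c x ->
  Gamma c x a b d = Gamma c x a d b.
Proof.
move=> ac cx; have [v tv] := fs_fiber ac cx.
suff E p q : Gamma c x a p q = 2^-1 * (Gamma c x a p q + Gamma c x a q p).
  by rewrite E [RHS]E addrC.
have [_ /(_ a p q)] := FG ac tv; rewrite /= => {1}->.
rewrite /spray_coefficient pdvE.
pose B e f := 2^-1 * Gamma c x a e f.
transitivity ('D_(e_ p) ('D_(e_ q)
   (fun w : 'rV[R]_n => \sum_(e < n) \sum_(f < n) B e f * w ord0 e * w ord0 f)) v).
  (* Two nested derivatives require the spray to be quadratic near every [w] near [v];
     [nbhs_interior] provides this doubled neighbourhood. *)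
  apply: near_eq_derive; have := tset_fiber_near ac tv.
  move=> /nbhs_interior; apply: filterS => w nw; rewrite pdvE.
  apply: near_eq_derive; apply: filterS nw => u tu.
  have [-> _] := FG ac tu; rewrite mulr_sumr; apply: eq_bigr => e _.
  by rewrite mulr_sumr; apply: eq_bigr => f _; rewrite /B !mulrA.
by rewrite derive2_quadratic mulrDr.
Qed.

Lemma berwald_law c c' x (a e f : 'I_n) : atlas c -> atlas c' ->
  transition_dom c c' x ->
  \sum_(b < n) \sum_(d < n)
      transition_mx c c' x e b * transition_mx c c' x f d
        * Gamma c' (transition c c' x) a b d
  = \sum_(d < n) transition_mx c c' x d a * Gamma c x d e f
      - transition_hess c c' x e f a.
Proof.
move=> ac ac' cx; have [cx0 _] := cx; have [v tv] := fs_fiber ac cx0.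
set T := transition_mx c c' x; set y := transition c c' x.
(* [B] is the defect of the law. The spray law kills its quadratic form on admissible velocities, so
   its Hessian [B e f + B f e] vanishes, and symmetry then gives [B = 0]. *)
pose B e f := \sum_(d < n) T d a * Gamma c x d e f - transition_hess c c' x e f a
  - \sum_(b < n) \sum_(d < n) T e b * T f d * Gamma c' y a b d.
have yc : cimg c' y by have [] := transition_img cx.
have Bsym p q : B p q = B q p.
  rewrite /B (transition_hessC ac ac' _ _ _ cx) [in RHS]exchange_big/=; congr (_ - _ - _).
    by apply: eq_bigr => d _; rewrite berwald_sym.
  by apply: eq_bigr => b _; apply: eq_bigr => d _; rewrite berwald_sym//; ring.
have B0 w : tset c (fs_dom F) (x, w) ->
    \sum_(e < n) \sum_(f < n) B e f * w ord0 e * w ord0 f = 0.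
  move=> tw; have := spray_transition a ac ac' tw cx.
  have [/(_ a)-> _] := FG ac' (tset_transition ac ac' tw cx).
  under eq_bigr => d _ do rewrite (FG ac tw).1 mulrCA.
  rewrite -mulr_sumr -mulrDr => /(mulfI _)-/(_ ltac:(by rewrite invr_eq0 pnatr_eq0)) eqw.
  rewrite quadratic_transition_algebra; apply/eqP; rewrite subr_eq0 subr_eq.
  apply/eqP; rewrite [LHS]eqw; congr (_ + _).
  by apply: eq_bigr => b _; apply: eq_bigr => d _; rewrite !tangent_transition2E.
have : B e f + B f e = 0.
  rewrite -(derive2_quadratic B v).
  set q := (fun w : 'rV[R]_n => _); have n0 : \forall w \near v, q w = 0.
    by apply: filterS (tset_fiber_near ac tv) => w; exact: B0.
  transitivity ('D_(e_ e) (cst (0 : R)) v); last by rewrite derive_cst.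
  apply: near_eq_derive; move/nbhs_interior: n0; apply: filterS => w nw.
  by rewrite -[RHS](derive_cst (0 : R) w (e_ f)); apply: near_eq_derive.
rewrite (Bsym f e) -mulr2n => /eqP; rewrite mulrn_eq0 /= subr_eq0 => /eqP Be.
exact: esym Be.
Qed.

End Berwald.

(** * The induced connection and metrizability *)

Section BerwaldConnection.
Variables (R : realType) (n : nat) (M : manifold R n) (F : finsler_spacetime M).
Implicit Types c : chart R n M.

Lemma spray_smooth c a : atlas c -> smooth_on (tset c (fs_dom F)) (spray F c a).
Proof.
move=> ac; have oU := tset_open (F := F) ac; have sL := in_chart_smooth (F := F) ac.
rewrite /spray; apply: smoothM => //; first exact: smooth_cst.
apply: smooth_sum => // q _; apply: smoothM => //.
  apply: smooth_invmx => // [z tz|i j]; first exact: fs_nondegenerate.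
  apply: (@eq_smooth _ _ _ _ (fun z => 2^-1 * pdv i (pdv j (in_chart (fs_L F) c)) z)) => //.
    by move=> z _; rewrite mxE.
  by apply: smoothM => //; [exact: smooth_cst|do 2 apply: smooth_derive].
apply: smoothB => //; last exact: smooth_derive.
apply: smooth_sum => // m _; apply: smoothM => //; last by do 2 apply: smooth_derive.
apply: (@smooth_coord _ _ _ _ _ (fun z : 'rV[R]_n * 'rV[R]_n => z.2)) => //.
apply: smooth_linear => z; exact: cvg_snd.
Qed.

Variable Gamma : coefficients M.
Hypothesis FG : berwald_with F Gamma.

Lemma smooth_section (U : set ('rV[R]_n * 'rV[R]_n)) (f : 'rV[R]_n * 'rV[R]_n -> R) v :
  smooth_on U f -> smooth_on [set x | U (x, v)] (fun x => f (x, v)).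
Proof.
have lin : linear (fun x : 'rV[R]_n => (x, 0 : 'rV[R]_n)).
  by move=> k x y; congr pair; rewrite /= scaler0 addr0.
pose linM := GRing.isLinear.Build _ _ _ _ _ lin.
pose iota : {linear 'rV[R]_n -> ('rV[R]_n * 'rV[R]_n)%type} :=
  HB.pack (fun x : 'rV[R]_n => (x, 0 : 'rV[R]_n)) linM.
have ci : continuous iota.
  move=> x; apply: (@differentiable_continuous _ _ _ x (fun x : 'rV[R]_n => (x, 0 : 'rV[R]_n))).
  by apply: differentiable_pair => //; exact: differentiable_cst.
have E x : iota x + (0, v) = (x, v) by congr pair; rewrite /= ?addr0 ?add0r.
move=> /(@smooth_line _ _ _ _ U f iota (0, v) ci).
rewrite (_ : [set y | _] = [set x | U (x, v)]); last first.
  by apply/seteqP; split => x /=; rewrite E.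
by rewrite (_ : (fun y => _) = fun x => f (x, v)) //; apply/funext => x; rewrite E.
Qed.

(* Near x the velocity v can be frozen, which exhibits Gamma as a smooth
   function of x alone. *)
Lemma berwald_smooth c a b d : atlas c ->
  smooth_on (cimg c) (fun x => Gamma c x a b d).
Proof.
move=> ac; apply: (@smooth_union _ _ _ _ (fun v => [set x | tset c (fs_dom F) (x, v)])).
move=> x cx; have [v tv] := fs_fiber F ac cx; exists v => //.
have oU : open [set x | tset c (fs_dom F) (x, v)].
  rewrite openE => y ty.
  have [[A B] [/= nA nB] AB] : nbhs (y, v) (tset c (fs_dom F)).
    by apply: open_nbhs_nbhs; split; [exact: tset_open|].
  by apply: filterS nA => w Aw; apply: AB; split => //=; exact: nbhs_singleton.
apply: (@eq_smooth _ _ _ _ (fun x => spray_coefficient F c (x, v) a b d)) => //.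
  by move=> y ty; have [_ ->] := FG ac ty.
apply: smooth_section; do 2 apply: smooth_derive; exact: spray_smooth.
Qed.

(** Kept transparent so that the coefficients reduce to [Gamma] as total functions. *)
Definition berwald_connection : affine_connection M.
Proof.
apply: (@AffineConnection _ _ _ Gamma) => [|c c' x a e f ac ac' cx phi].
  exact: berwald_smooth.
have := berwald_law FG a e f ac ac' cx.
under eq_bigr do under eq_bigr do rewrite !mxE.
by move=> ->; congr (_ - _); apply: eq_bigr => d _; rewrite mxE.
Defined.

End BerwaldConnection.

(** * Levi-Civita connections as torsion-free metric-compatible ones *)

Section ChristoffelAlgebra.
Variables (K : realFieldType) (n : nat) (g : 'M[K]_n).
Variables (dg G : 'I_n -> 'I_n -> 'I_n -> K).
Hypotheses (ug : g \in unitmx) (gS : forall a b, g a b = g b a).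
Hypothesis dgS : forall a b d, dg a b d = dg a d b.

Lemma sum_invmx (X Y : 'I_n -> K) :
  (forall a, X a = \sum_(s < n) invmx g a s * Y s) <->
  (forall a, \sum_(s < n) g a s * X s = Y a).
Proof.
have col_eq (U V : 'cV[K]_n) : (forall a, U a ord0 = V a ord0) <-> U = V.
  by split=> [e|-> //]; apply/matrixP => i j; rewrite ord1.
pose x : 'cV[K]_n := \col_a X a; pose y : 'cV[K]_n := \col_a Y a.
have E1 a : (invmx g *m y) a ord0 = \sum_(s < n) invmx g a s * Y s.
  by rewrite mxE; apply: eq_bigr => s _; rewrite mxE.
have E2 a : (g *m x) a ord0 = \sum_(s < n) g a s * X s.
  by rewrite mxE; apply: eq_bigr => s _; rewrite mxE.
split=> H a.
  have xE : x = invmx g *m y by apply/col_eq => i; rewrite E1 mxE.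
  by rewrite -E2 xE mulKVmx// mxE.
have yE : g *m x = y by apply/col_eq => i; rewrite E2 mxE.
by rewrite -E1 -yE mulKmx// mxE.
Qed.

(** Koszul's argument at a single point, with [dg a b d] for the derivative of [g_bd] along [a]. For
    the lowered coefficients [lG], compatibility reads [dg a b d = lG d a b + lG b a d]; permuting
    the indices and using the symmetry of [lG] solves for it. *)
Lemma christoffelP : (forall a b d, G a b d = G a d b) ->
  (forall a b d, G a b d = 2^-1 * \sum_(s < n) invmx g a s *
     (dg b s d + dg d s b - dg s b d)) <->
  (forall a b d, dg a b d - \sum_(s < n) G s a b * g s d
     - \sum_(s < n) G s a d * g b s = 0).
Proof.
move=> GS; pose lG a b d := \sum_(s < n) g a s * G s b d.
have lGS a b d : lG a b d = lG a d b by apply: eq_bigr => s _; rewrite GS.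
have E1 a b d : \sum_(s < n) G s a b * g s d = lG d a b.
  by apply: eq_bigr => s _; rewrite mulrC gS.
have E2 a b d : \sum_(s < n) G s a d * g b s = lG b a d.
  by apply: eq_bigr => s _; rewrite mulrC.
have -> : (forall a b d, G a b d = 2^-1 * \sum_(s < n) invmx g a s *
     (dg b s d + dg d s b - dg s b d)) <->
   (forall b d a, lG a b d = 2^-1 * (dg b a d + dg d a b - dg a b d)).
  split=> [H b d|H a b d].
    apply/(sum_invmx (fun s => G s b d) (fun s => 2^-1 * (dg b s d + dg d s b - dg s b d))).
    by move=> a; rewrite H mulr_sumr; apply: eq_bigr => s _; rewrite mulrCA.
  have /(sum_invmx (fun s => G s b d) (fun s => 2^-1 * (dg b s d + dg d s b - dg s b d)))-> := H b d.
  by rewrite mulr_sumr; apply: eq_bigr => s _; rewrite mulrCA.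
split=> H.
  move=> a b d; rewrite E1 E2 !H (dgS a d b) (dgS b d a) (dgS d b a); lra.
have {}H a b d : dg a b d = lG d a b + lG b a d.
  by apply/eqP; rewrite -subr_eq0 opprD addrA -E1 -E2 H.
move=> b d a; rewrite !H (lGS d b a) (lGS a d b) (lGS b d a); lra.
Qed.

End ChristoffelAlgebra.

Section MetricChart.
Variables (R : realType) (n : nat) (M : manifold R n) (g : pseudo_riemannian M).
Implicit Types c : chart R n M.

Lemma form_in_chart_sym c x a b :
  form_in_chart (pr_form g) c x a b = form_in_chart (pr_form g) c x b a.
Proof.
rewrite [LHS]mxE [RHS]mxE; move: (tvec _ _).2 (tvec _ _).2 => u w.
(* A 1x1 matrix equals its transpose, and transposing [u g w^T] exchanges [u] and [w] because [g] is
   symmetric. *)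
have := mxE trmx_key (fun i j => (u *m pr_form g (cinv c x) *m w^T) j i) ord0 ord0.
by rewrite -/(trmx _) !trmx_mul trmxK pr_sym mulmxA => ->.
Qed.

Lemma form_in_chart_transition c x : atlas c -> cimg c x ->
  form_in_chart (pr_form g) c x =
  transition_mx c (chart_at (cinv c x)) x *m pr_form g (cinv c x)
   *m (transition_mx c (chart_at (cinv c x)) x)^T.
Proof.
move=> ac cx; apply/matrixP => a b; rewrite mxE !tvecE//=.
set T := transition_mx _ _ _; set p := cinv c x.
have rT q : 'D_(basis_vec R q) (transition c (chart_at p)) x = row q T.
  by apply/rowP => j; rewrite !mxE.
rewrite !rT -row_mul [LHS]mxE [RHS]mxE; apply: eq_bigr => j _.
by rewrite [(row a _) _ _]mxE; congr (_ * _); rewrite !mxE.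
Qed.

Lemma form_in_chart_unit c x : atlas c -> cimg c x ->
  form_in_chart (pr_form g) c x \in unitmx.
Proof.
move=> ac cx; rewrite form_in_chart_transition// !unitmx_mul unitmx_tr pr_nondegenerate andbT.
rewrite andbb; apply: transition_mx_unit => //; first exact: chart_at_atlas.
exact: transition_dom_chart_at.
Qed.

Lemma partial_metric_sym c a b d x :
  partial a (metric_comp g c b d) x = partial a (metric_comp g c d b) x.
Proof.
rewrite (_ : metric_comp g c b d = metric_comp g c d b) //.
by apply/funext => y; exact: form_in_chart_sym.
Qed.

Lemma levi_civita_compatible (nabla : affine_connection M) : torsion_free nabla ->
  is_levi_civita g nabla <-> metric_compatible (MetricAffine g nabla).
Proof.
move=> tf; split=> H c x ac cx.
  apply/(@christoffelP _ _ (form_in_chart (pr_form g) c x)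
    (fun a b d => partial a (metric_comp g c b d) x)) => [|a b|a b d|a b d|a b d].
  - exact: form_in_chart_unit.
  - exact: form_in_chart_sym.
  - exact: partial_metric_sym.
  - exact: tf.
  - exact: H.
apply/(@christoffelP _ _ (form_in_chart (pr_form g) c x)
    (fun a b d => partial a (metric_comp g c b d) x)) => [|a b|a b d|a b d|a b d].
- exact: form_in_chart_unit.
- exact: form_in_chart_sym.
- exact: partial_metric_sym.
- exact: tf.
- exact: H.
Qed.

End MetricChart.

(** * A Berwald spacetime with a non-parallel metric *)

(** The base consists of balls with rational centre and radius [1/(k+1)]. When this radius is below
    [e/2], such a ball containing [x] lies in the [e]-ball around [x]. *)
Lemma row_second_countable (R : realType) n : @second_countable 'rV[R]_n.
Proof.
pose U (p : 'rV[rat]_n * nat) : set 'rV[R]_n := ball (map_mx (@ratr R) p.1 : 'rV[R]_n) p.2.+1%:R^-1.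
exists (range U).
  by apply: sub_countable (card_image_le _ _) _; exact: countableP.
split=> [_ [p _ <-]|x V /nbhs_ballP[e /= e0 xeV]]; first exact: ball_open.
have [//|k] := @ltr_add_invr R 0 (e / 2) _; first by rewrite divr_gt0.
rewrite add0r => ke; have k0 : 0 < k.+1%:R^-1 :> R by [].
have near_rat i : exists q : rat, `|x ord0 i - ratr q| < k.+1%:R^-1 :> R.
  have /rat_in_itvoo[q] : x ord0 i - k.+1%:R^-1 < x ord0 i + k.+1%:R^-1.
    by rewrite ltrBlDr -addrA ltrDl addr_gt0.
  by rewrite in_itv/= -lter_distl => ?; exists q; rewrite distrC.
pose q := \row_i projT1 (cid (near_rat i)).
have xq : ball (map_mx (@ratr R) q : 'rV[R]_n) k.+1%:R^-1 x.
  split=> // i j; rewrite ord1 !mxE -ball_normE /= distrC.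
  exact: projT2 (cid (near_rat j)).
exists (U (q, k)); first by split=> //; exists (q, k).
move=> z qz; apply: xeV; rewrite [e]splitr.
apply: (@ball_triangle _ _ (map_mx (@ratr R) q)); apply: (le_ball (ltW ke)) => //.
exact: ball_sym.
Qed.

Section FlatManifold.
Variables (R : realType) (n : nat).

Lemma open_range_id : open (id @` [set: 'rV[R]_n]).
Proof. by rewrite image_id; exact: openT. Qed.

Lemma continuous_id_within (A : set 'rV[R]_n) : {within A, continuous (@id 'rV[R]_n)}.
Proof. by apply: continuous_subspaceT => x; exact: cvg_id. Qed.

Definition id_chart : chart R n 'rV[R]_n :=
  @Chart R n 'rV[R]_n setT id id openT open_range_id (fun _ _ => erefl)
    (@continuous_id_within _) (@continuous_id_within _).

Lemma id_chart_smooth (c c' : chart R n 'rV[R]_n) :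
  [set id_chart] c -> [set id_chart] c' ->
  smooth_on (transition_dom c c') (transition c c').
Proof.
move=> -> ->; rewrite (_ : transition _ _ = idfun) //.
by apply: (@smooth_linear _ _ _ _ idfun) => x; exact: cvg_id.
Qed.

Definition flat_manifold : manifold R n :=
  @Manifold R n 'rV[R]_n (@norm_hausdorff _ _) (@row_second_countable R n)
    [set id_chart] (fun=> id_chart) (fun=> erefl) (fun=> I) id_chart_smooth.

Lemma tvec_flat (z : 'rV[R]_n * 'rV[R]_n) : tvec (M := flat_manifold) id_chart z = z.
Proof.
case: z => x v; congr pair; rewrite /= (_ : transition _ _ = idfun) //.
by rewrite (@diff_lin _ _ _ idfun) // => y; exact: cvg_id.
Qed.

Lemma pdx_snd (h : 'rV[R]_n -> R) a z : pdx a (fun z => h z.2) z = 0.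
Proof. exact: (derive0 h z.2). Qed.

Lemma pdv_snd (h : 'rV[R]_n -> R) a :
  pdv a (fun z => h z.2) = fun z => 'D_(basis_vec R a) h z.2.
Proof. by apply/funext => -[x v]; rewrite pdvE. Qed.

Lemma smooth_row_coord (U : set 'rV[R]_n) a : open U ->
  smooth_on U (fun v => v ord0 a).
Proof.
move=> oU; apply: (@smooth_coord _ _ _ _ _ (@id 'rV[R]_n)) => //.
by apply: (@smooth_linear _ _ _ _ idfun) => x; exact: cvg_id.
Qed.

Lemma smooth_snd_coord (U : set ('rV[R]_n * 'rV[R]_n)) a : open U ->
  smooth_on U (fun z => z.2 ord0 a).
Proof.
move=> oU; apply: (@smooth_coord _ _ _ _ _ (fun z : 'rV[R]_n * 'rV[R]_n => z.2)) => //.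
by apply: smooth_linear => z; exact: cvg_snd.
Qed.

End FlatManifold.

(** * A conformally Euclidean metric that is not parallel *)

Section ConformalMetric.
Variables (R : realType) (n : nat) (n0 : (0 < n)%N).
Local Notation flat := (flat_manifold R n).
Let i0 := Ordinal n0.

(** Positive everywhere, hence conformal on all of space, and a perfect square, so that its inverse
    square root, which normalizes the form in [has_signature], is explicit. *)
Definition conformal_factor (p : 'rV[R]_n) : R :=
  (1 + p ord0 i0 * p ord0 i0) * (1 + p ord0 i0 * p ord0 i0).

Lemma conformal_factor_smooth (U : set 'rV[R]_n) : open U -> smooth_on U conformal_factor.
Proof.
move=> oU; have s1 : smooth_on U (fun p : 'rV[R]_n => 1 + p ord0 i0 * p ord0 i0).
  apply: smoothD => //; first exact: smooth_cst.
  by apply: smoothM => //; exact: smooth_row_coord.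
exact: smoothM.
Qed.

Let base_gt0 (p : 'rV[R]_n) : 0 < 1 + p ord0 i0 * p ord0 i0.
Proof. by rewrite ltr_pwDl// -expr2 sqr_ge0. Qed.

Definition conformal_form (p : flat) : 'M[R]_n := (conformal_factor p)%:M.

Lemma conformal_form_sym p : (conformal_form p)^T = conformal_form p.
Proof. exact: tr_scalar_mx. Qed.

Lemma conformal_form_unit p : conformal_form p \in unitmx.
Proof.
rewrite unitmxE det_scalar unitrX// unitfE gt_eqF// mulr_gt0//.
Qed.

Lemma conformal_form_signature : exists k, forall p, has_signature k (conformal_form p).
Proof.
(* With [k = n] every index lies below [k], so all signs are +1. *)
exists n => p; exists ((1 + p ord0 i0 * p ord0 i0)^-1)%:M; split.
  by rewrite unitmxE det_scalar unitrX// unitrV unitfE gt_eqF.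
rewrite tr_scalar_mx -!scalar_mxM; apply/matrixP => i j.
rewrite !mxE ltn_ord; congr (_ *+ _); rewrite /conformal_factor.
by field; rewrite gt_eqF.
Qed.

Lemma form_in_chart_conformal a b :
  (fun x => form_in_chart (M := flat) conformal_form (id_chart R n) x a b)
  = fun x => if a == b then conformal_factor x else 0.
Proof.
apply/funext => x; rewrite mxE !tvec_flat /= /conformal_form.
rewrite mul_mx_scalar -scalemxAl mxE /basis_vec trmx_delta mul_delta_mx_cond.
by case: eqP => _; rewrite ?mulr1n ?mulr0n mxE ?eqxx ?mulr1 ?mulr0.
Qed.

Lemma conformal_form_smooth c a b : @atlas R n flat c ->
  smooth_on (cimg c) (fun x => form_in_chart conformal_form c x a b).
Proof.
move=> ->; rewrite form_in_chart_conformal.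
have oU : open (cimg (id_chart R n)) by exact: cimg_open.
case: eqP => _; first exact: conformal_factor_smooth.
exact: smooth_cst.
Qed.

Definition conformal_metric : pseudo_riemannian flat :=
  PseudoRiemannian conformal_form_sym conformal_form_unit conformal_form_signature
    conformal_form_smooth.

Lemma conformal_metric_incompatible (nabla : affine_connection flat) :
  conn_coef nabla = (fun _ _ _ _ _ => 0) ->
  ~ metric_compatible (MetricAffine conformal_metric nabla).
Proof.
(* For zero coefficients the component [Q_000] is the derivative of [(1 + x^2)^2]; it vanishes at
   the origin but equals 8 at [x = 1], hence this test point. *)
move=> n00 /(_ (id_chart R n) (basis_vec R i0) erefl).
have i : cimg (id_chart R n) (basis_vec R i0) by exists (basis_vec R i0).
move=> /(_ i i0 i0 i0); rewrite /nonmetricity /= n00.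
rewrite !big1; [|by move=> *; rewrite mul0r..].
rewrite /partial /metric_comp form_in_chart_conformal eqxx !subr0.
pose h (p : 'rV[R]_n) : R := 1 + p ord0 i0 * p ord0 i0.
have sh : smooth_on setT h.
  apply: smoothD; [exact: openT|exact: smooth_cst|].
  by apply: smoothM; [exact: openT|exact: smooth_row_coord openT..].
have dh : differentiable h (basis_vec R i0) by exact: smooth_differentiable sh I.
have dc := @differentiable_row_coord R n (basis_vec R i0) i0.
rewrite (_ : (fun x => _) = fun x => h x * h x) // derive_mulE//.
have -> : 'D_(basis_vec R i0) h (basis_vec R i0) = 2.
  rewrite /h; rewrite deriveD ?derive_cst ?add0r; last 2 first.
  - exact: derivable_cst.
  - by apply: diff_derivable; exact: differentiableM.
  by rewrite [LHS]derive_mulE// derive_row_coord !mxE !eqxx mulr1.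
by rewrite /h !mxE !eqxx /=; clear n00 => ?; lra.
Qed.

End ConformalMetric.

(** * Minkowski space as a Berwald spacetime with zero coefficients *)

Section Minkowski.
Variables (R : realType) (n : nat).
Local Notation flat := (flat_manifold R n).

Definition minkowski_mx : 'M[R]_n := diag_mx (\row_i (if (i < 1)%N then 1 else -1)).

Definition minkowski (v : 'rV[R]_n) : R :=
  \sum_(e < n) \sum_(f < n) minkowski_mx e f * v ord0 e * v ord0 f.

(** Restricting L to vectors where it is positive excludes the zero section and lets the whole
    domain serve as the timelike set. *)
Definition minkowski_dom : set (tangent flat) := [set w | 0 < minkowski w.2].

Definition minkowski_L (w : tangent flat) : R := minkowski w.2.

Lemma minkowskiZ l v : minkowski (l *: v) = l ^+ 2 * minkowski v.
Proof.
rewrite mulr_sumr; apply: eq_bigr => e _; rewrite mulr_sumr.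
by apply: eq_bigr => f _; rewrite !mxE; ring.
Qed.

Lemma minkowski_basis0 (i0 : 'I_n) : i0 = 0%N :> nat -> minkowski (basis_vec R i0) = 1.
Proof.
move=> i00; rewrite /minkowski.
transitivity (\sum_(e < n) basis_vec R i0 ord0 e *
    \sum_(f < n) basis_vec R i0 ord0 f * minkowski_mx e f).
  apply: eq_bigr => e _; rewrite mulr_sumr; apply: eq_bigr => f _; ring.
by rewrite !sum_basis_vec !mxE eqxx i00 mulr1n.
Qed.

Lemma minkowski_mxK : minkowski_mx *m minkowski_mx = 1%:M.
Proof.
rewrite mulmx_diag; apply/matrixP => i j; rewrite !mxE.
by case: (_ < _)%N; rewrite ?mulr1// mulrNN mulr1.
Qed.

Lemma smooth_minkowski U : open U -> smooth_on U (fun z : 'rV[R]_n * 'rV[R]_n => minkowski z.2).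
Proof.
move=> oU; apply: smooth_sum => // e _; apply: smooth_sum => // f _.
apply: smoothM => //; last exact: smooth_snd_coord.
by apply: smoothM => //; [exact: smooth_cst|exact: smooth_snd_coord].
Qed.

Lemma continuous_minkowski : continuous (fun z : 'rV[R]_n * 'rV[R]_n => minkowski z.2).
Proof.
by move=> z; apply: differentiable_continuous; exact: smooth_differentiable (smooth_minkowski openT) I.
Qed.

Lemma in_chart_minkowski : in_chart (M := flat) minkowski_L (id_chart R n) = fun z => minkowski z.2.
Proof. by apply/funext => z; rewrite /in_chart tvec_flat. Qed.

Lemma tset_minkowski : tset (M := flat) (id_chart R n) minkowski_dom = [set z | 0 < minkowski z.2].
Proof.
apply/seteqP; split => z; rewrite /tset /= tvec_flat; first by case.
by move=> z0; split=> //; exists z.1.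
Qed.

Lemma tset_minkowski_open : open [set z : 'rV[R]_n * 'rV[R]_n | 0 < minkowski z.2].
Proof.
apply: (open_comp (f := fun z : 'rV[R]_n * 'rV[R]_n => minkowski z.2) (D := [set x | 0 < x])).
  by move=> z _; exact: continuous_minkowski.
exact: open_gt.
Qed.

Lemma L_metric_minkowski z : L_metric (M := flat) minkowski_L (id_chart R n) z = minkowski_mx.
Proof.
apply/matrixP => a b; rewrite mxE in_chart_minkowski !pdv_snd.
rewrite [X in _ * X]derive2_quadratic !mxE eq_sym.
case: eqP => [->|_]; last by rewrite !mulr0n addr0 mulr0.
by rewrite !mulr1n; lra.
Qed.

(** L is continuous on all of TM and serves as its own extension. A boundary point lies in the
    closure of [L > 0], so [L >= 0] there, and outside this open set, so [L <= 0]. *)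
Lemma minkowski_vanishing :
  vanishing_extension minkowski_dom minkowski_L minkowski_L.
Proof.
split=> // c ->; split; last first.
  by rewrite in_chart_minkowski; apply: continuous_subspaceT; exact: continuous_minkowski.
rewrite tset_minkowski => z _ cz; rewrite tvec_flat => iz; apply/eqP.
rewrite eq_le leNgt; apply/andP; split.
  apply/negP => z0; apply: iz.
  by move/interior_id: tset_minkowski_open => ->.
have : closure [set z : 'rV[R]_n * 'rV[R]_n | 0 <= minkowski z.2] z.
  by apply: closureS cz => y /ltW.
suff /closure_id <- : closed [set z : 'rV[R]_n * 'rV[R]_n | 0 <= minkowski z.2] by [].
apply: (closed_comp (f := fun z : 'rV[R]_n * 'rV[R]_n => minkowski z.2) (D := [set x | 0 <= x])).
  by move=> y _; exact: continuous_minkowski.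
exact: closed_ge.
Qed.

Hypothesis n0 : (0 < n)%N.
Let i0 := Ordinal n0.

Lemma minkowski_dom_conic : conic_subbundle minkowski_dom.
Proof.
have e0 p : minkowski_dom (p, basis_vec R i0).
  by rewrite /minkowski_dom/= minkowski_basis0// ltr01.
split.
- by exists (0, basis_vec R i0); exact: e0.
- by move=> c ->; rewrite tset_minkowski; exact: tset_minkowski_open.
- move=> p; rewrite /minkowski_dom/= -(scale0r (basis_vec R i0)) minkowskiZ.
  by rewrite expr2 !mul0r ltxx.
- by move=> p; exists (basis_vec R i0).
- by move=> p v l l0; rewrite /minkowski_dom/= minkowskiZ => ?; rewrite mulr_gt0// exprn_gt0.
Qed.

Lemma minkowski_nondegenerate c z : @atlas R n flat c -> tset c minkowski_dom z ->
  L_metric minkowski_L c z \in unitmx.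
Proof. by move=> -> _; rewrite L_metric_minkowski; case/mulmx1_unit: minkowski_mxK. Qed.

Lemma minkowski_smooth c : @atlas R n flat c ->
  smooth_on (tset c minkowski_dom) (in_chart minkowski_L c).
Proof.
move=> ->; rewrite tset_minkowski in_chart_minkowski.
by apply: smooth_minkowski; exact: tset_minkowski_open.
Qed.

Lemma minkowski_timelike : exists T : set (tangent flat),
  [/\ T !=set0, T `<=` minkowski_dom, conic T,
      (forall w, T w -> 0 < minkowski_L w) /\
      (forall c z, @atlas R n flat c -> tset c T z -> has_signature 1 (L_metric minkowski_L c z))
    & exists Lbar, vanishing_extension T minkowski_L Lbar].
Proof.
have [? _ _ _ ?] := minkowski_dom_conic; exists minkowski_dom; split=> //.
  split=> // c z -> _; exists 1%:M; rewrite unitmx1; split=> //.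
  by rewrite L_metric_minkowski mul1mx trmx1 mulmx1.
by exists minkowski_L; exact: minkowski_vanishing.
Qed.

Definition minkowski_spacetime : finsler_spacetime flat :=
  @FinslerSpacetime R n flat minkowski_dom minkowski_L minkowski_dom_conic
    minkowski_smooth (fun p v l _ _ => minkowskiZ l v)
    minkowski_nondegenerate minkowski_timelike.

Lemma minkowski_berwald : berwald_with minkowski_spacetime (fun _ _ _ _ _ => 0).
Proof.
have S0 a : spray minkowski_spacetime (id_chart R n) a = cst 0.
  apply/funext => z; rewrite /spray /= in_chart_minkowski big1 ?mulr0// => q _.
  rewrite pdx_snd big1 ?subrr ?mulr0// => m _.
  by rewrite pdv_snd (pdx_snd ('D_(basis_vec R q) minkowski)) mulr0.
move=> c z -> _; split=> [a|a b d]; first last.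
  have D0 u : 'D_u (cst 0 : 'rV[R]_n * 'rV[R]_n -> R) = cst 0.
    by apply/funext => y; exact: derive_cst.
  by rewrite /spray_coefficient S0 /pdv D0 derive_cst.
rewrite S0 big1 ?mulr0// => b _; rewrite big1// => d _; by rewrite !mul0r.
Qed.

End Minkowski.

(** The example needs positive dimension: in dimension 0 every tangent vector is zero, while a conic
    subbundle is non-empty and avoids zero vectors. *)
Theorem proposition2 (R : realType) (n : nat) :
  (forall (M : manifold R n) (F : finsler_spacetime M)
          (Gamma : coefficients M),
     berwald_with F Gamma ->
     exists nabla : affine_connection M,
       [/\ conn_coef nabla = Gamma,
           (forall g : pseudo_riemannian M,
              same_affine_structure F (MetricAffine g nabla) /\
              torsion_free (ma_connection (MetricAffine g nabla)))
         & metrizable F <->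
           exists g : pseudo_riemannian M,
             metric_compatible (MetricAffine g nabla)])
  /\
  ((0 < n)%N ->
   exists (M : manifold R n) (F : finsler_spacetime M)
          (nabla : affine_connection M) (g : pseudo_riemannian M),
     induced_connection F nabla /\ ~ metric_compatible (MetricAffine g nabla)).
Proof.
split=> [M F Gamma FG|n0].
  pose nabla := berwald_connection FG.
  have nablaE : conn_coef nabla = Gamma by [].
  have tf : torsion_free nabla.
    by move=> c x ac cx a b d; rewrite nablaE; apply: (berwald_sym FG).
  exists nabla; split=> // [g|]; first by split=> //; exists nabla.
  split=> [[g [nabla' FG' lc]]|[g mc]]; exists g; last first.
    by exists nabla => //; apply/levi_civita_compatible.
  apply/levi_civita_compatible => // c x ac cx a b d; rewrite -lc//.
  (* Uniqueness of the induced connection: at an admissible [v] over [x], both families of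
     coefficients equal the same velocity derivative of the spray. *)
  have [v tv] := fs_fiber F ac cx.
  have [_ /(_ a b d) e] := FG c _ ac tv; have [_ /(_ a b d) e'] := FG' c _ ac tv.
  by rewrite nablaE; apply: etrans e _.
pose nabla := berwald_connection (@minkowski_berwald R n n0 : berwald_with (minkowski_spacetime R n0) _).
exists (flat_manifold R n), (minkowski_spacetime R n0), nabla, (conformal_metric R n0).
by split; [exact: minkowski_berwald|exact: conformal_metric_incompatible].
Qed.
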